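(* Let $f_1,\dots,f_M:\mathbb{R}^n\to\mathbb{R}^n$ be locally Lipschitz with $f_i(0)=0$ for all $i\in\mathcal Q=\{1,\dots,M\}$. Let $(V,W)$ be a CLF pair for the switched system $\dot x(t)=f_{\sigma(t)}(x(t))$, $\sigma(t)\in\mathcal Q$, where $V$ is a piecewise smooth control-Lyapunov function with partition $\{\Omega_j\}_{j\in\{1,\dots,m\}}$, and let $\nu=\mathcal S[V]$ be the switching law generated from $V$. Then the closed-loop system $\dot x(t)=f_{\nu(x(t))}(x(t))$ is globally asymptotically stable excluding sliding motions.
   Context: Notation: $\mathbb N_m=\{1,\dots,m\}$, $\mathbb R_+=[0,\infty)$, $\mathcal N(x;\delta)=\{z\in\mathbb R^n:\|z-x\|<\delta\}$, $\mu$ is Lebesgue measure, $\overline{co}$ is closed convex hull. Filippov solutions: for $X:\mathbb R^n\to\mathbb R^n$, $F[X](x)=\bigcap_{\delta>0}\bigcap_{\mu(S)=0}\overline{co}\{X(\mathcal N(x;\delta)\setminus S)\}$. A Filippov solution of $\dot x=X(x)$ is an absolutely continuous $x(\cdot)$ with $\dot x(t)\in F[X](x(t))$ for almost all $t$. Piecewise smooth function: $g:\mathbb R^n\to\mathbb R$ is piecewise smooth if it is continuous and there are finitely many disjoint open sets $\Omega_1,\dots,\Omega_m$ such that $\bigcup_j\bar\Omega_j=\mathbb R^n$, $g$ is continuously differentiable on each $\Omega_j$, and each $\partial\Omega_j$ is a differential manifold. Such $g$ has directional derivatives $Dg(x;\eta)=\lim_{\delta\downarrow0}\frac1\delta(g(x+\delta\eta)-g(x))$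 for all $x,\eta\in\mathbb R^n$. PSCLF and CLF pair: a piecewise smooth $V:\mathbb R^n\to\mathbb R_+$ is a piecewise smooth control-Lyapunov function (PSCLF), and $(V,W)$ is a CLF pair, if $W:\mathbb R^n\to\mathbb R_+$ is continuous and: $V(x)>0$, $W(x)>0$ for all $x\neq0$, and $V(0)=0$; $\{x:V(x)\le\beta\}$ is bounded for each $\beta$; $\min_{i\in\mathcal Q}DV(x;f_i(x))\le -W(x)$ for all $x\in\mathbb R^n$. Let $V_j$ be the restriction of $V$ to $\bar\Omega_j$, and for $\hat x\in\partial\Omega_j$ set $\nabla V_j(\hat x)=\lim_{x\in\Omega_j,x\to\hat x}\nabla V_j(x)$ (this limit is taken to exist), so that $V_j(z)-V_j(x)=\langle\nabla V_j(x),z-x\rangle+o(\|z-x\|)$ for $x,z\in\bar\Omega_j$. Switching law $\nu=\mathcal S[V]$: for $j\in\mathbb N_m$, $i\in\mathcal Q$ let $$\mathcal D_{j,i}=\Big\{x\in\Omega_j:\langle\nabla V_j(x),f_i(x)\rangle<\min_{q\in\mathcal Q,q\ne i}\langle\nabla V_j(x),f_q(x)\rangle\Big\},$$ $\mathcal D_i=\bigcup_j\mathcal D_{j,i}$, $\partial\mathcal D=\bigcup_i\partial\mathcal D_i$. Set $\nu(x)=i$ if $x\in\mathcal D_i$, and $\nu(x)=\min\{i\in\mathcal Q:x\in\partial\mathcal D_i\}$ if $x\in\partial\mathcal D$. The sets $\mathcal D_i$ are open and disjoint; it is taken as standing that $\nu$ is admissible, i.e. $\bigcup_i\bar{\mathcal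 D}_i=\mathbb R^n$, and that $\partial\mathcal D$ has measure zero. Stability excluding sliding motions: write $f_{[\nu]}(x)=f_{\nu(x)}(x)$ and let $x(\cdot;z,\nu):\mathbb R_+\to\mathbb R^n$ denote a Filippov solution of $\dot x=f_{[\nu]}(x)$ with initial state $z$. For $\epsilon>0$ let $$\mathcal X_0(\epsilon,\nu)=\{x(\cdot;z,\nu):\|z\|\le\epsilon,\ \dot x(t;z,\nu)=f_{[\nu]}(x(t;z,\nu))\text{ for a.e. }t\in\mathbb R_+\}.$$ The closed-loop system is globally asymptotically stable excluding sliding motions if (i) for any $\epsilon>0$ there is $\delta>0$ such that every $x(\cdot;z,\nu)\in\mathcal X_0(\delta,\nu)$ satisfies $\|x(t;z,\nu)\|<\epsilon$ for all $t\in\mathbb R_+$, and (ii) $\lim_{t\to\infty}x(t;z,\nu)=0$ for every $x(\cdot;z,\nu)\in\mathcal X_0(\rho,\nu)$ and every $\rho>0$. *)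

(* Defs.v *)
From mathcomp Require Import all_boot all_order all_algebra.
From mathcomp Require Import all_classical all_reals all_analysis.

Set Implicit Arguments.
Unset Strict Implicit.
Unset Printing Implicit Defensive.

Import Order.TTheory GRing.Theory Num.Theory.
Import numFieldNormedType.Exports.

Local Open Scope classical_set_scope.
Local Open Scope ring_scope.

(* The library norm on 'rV[R]_n is the max norm; it has the same topology as
   the Euclidean norm below, which is the norm of all the estimates. *)
Definition dot (R : realType) (n : nat) (u v : 'rV[R]_n) : R :=
  \sum_(i < n) u ord0 i * v ord0 i.

Definition enorm (R : realType) (n : nat) (u : 'rV[R]_n) : R :=
  Num.sqrt (dot u u).

Definition boundary (T : topologicalType) (A : set T) : set T :=
  closure A `\` interior A.

Definition grad (R : realType) (n : nat) (g : 'rV[R]_n -> R) (x : 'rV[R]_n) :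
    'rV[R]_n :=
  \row_(i < n) 'D_(delta_mx ord0 i) g x.

Definition locally_lipschitz (R : realType) (n : nat)
    (g : 'rV[R]_n -> 'rV[R]_n) : Prop :=
  forall x : 'rV[R]_n, exists2 U : set 'rV[R]_n, nbhs x U & [lipschitz g z | z in U].

(* Lebesgue measure on R^n: the library only has it for n = 1, hence the
   outer measure given by countable covers with boxes ]a, b]; a box with
   b i < a i for some i is empty and has volume 0. *)
Definition box (R : realType) (n : nat) (c : 'rV[R]_n * 'rV[R]_n) :
    set 'rV[R]_n :=
  [set x | forall i, c.1 ord0 i < x ord0 i <= c.2 ord0 i].

Definition box_volume (R : realType) (n : nat) (c : 'rV[R]_n * 'rV[R]_n) : R :=
  \prod_(i < n) Num.max 0 (c.2 ord0 i - c.1 ord0 i).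

Definition lebesgue_outer (R : realType) (n : nat) (S : set 'rV[R]_n) : \bar R :=
  ereal_inf [set (\sum_(0 <= k <oo) (box_volume (c k))%:E)%E |
    c in [set c : nat -> 'rV[R]_n * 'rV[R]_n | S `<=` \bigcup_k box (c k)]].

Definition null_set (R : realType) (n : nat) (S : set 'rV[R]_n) : Prop :=
  lebesgue_outer S = 0%E.

(* \overline{co} A, as the smallest closed convex set containing A *)
Definition closed_convex_hull (R : realType) (n : nat) (A : set 'rV[R]_n) :
    set 'rV[R]_n :=
  smallest [set C : set 'rV[R]_n | convex_set C /\ closed C] A.

Definition filippov_map (R : realType) (n : nat) (X : 'rV[R]_n -> 'rV[R]_n)
    (x : 'rV[R]_n) : set 'rV[R]_n :=
  [set v | forall (delta : R) (S : set 'rV[R]_n), 0 < delta -> null_set S ->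
     closed_convex_hull
       (X @` ([set z | enorm (z - x) < delta] `\` S)) v].

Definition abs_continuous_on (R : realType) (n : nat) (a b : R)
    (x : R -> 'rV[R]_n) : Prop :=
  forall e : R, 0 < e -> exists2 d : R, 0 < d &
    forall (k : nat) (u v : 'I_k -> R),
      (forall i, [/\ a <= u i, u i <= v i & v i <= b]) ->
      trivIset [set: 'I_k] (fun i => `]u i, v i[%classic) ->
      \sum_(i < k) (v i - u i) < d ->
      \sum_(i < k) enorm (x (v i) - x (u i)) < e.

(* Solutions live on [0, +oo[: the values of x on ]-oo, 0[ are irrelevant, and
   absolute continuity is meant on compact intervals. *)
Record filippov_solution (R : realType) (n : nat) (X : 'rV[R]_n -> 'rV[R]_n)
    (z : 'rV[R]_n) (x : R -> 'rV[R]_n) : Prop := {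
  filippov_init : x 0 = z ;
  filippov_ac : forall T : R, 0 < T -> abs_continuous_on 0 T x ;
  filippov_incl : {ae (@lebesgue_measure R), forall t : R, 0 <= t ->
    derivable x t 1 /\ filippov_map X (x t) (derive1 x t)}
}.

Definition C1_scalar_on (R : realType) (n : nat) (U : set 'rV[R]_n)
    (g : 'rV[R]_n -> R) : Prop :=
  forall x, U x -> differentiable g x /\ {for x, continuous (grad g)}.

Definition C1_on (R : realType) (n : nat) (U : set 'rV[R]_n)
    (phi : 'rV[R]_n -> 'rV[R]_n) : Prop :=
  forall x, U x -> differentiable phi x /\ {for x, continuous (jacobian phi)}.

(* Embedded C^1 submanifold of R^n: around each of its points, a C^1
   diffeomorphism phi (with inverse psi) from an open set U onto an open set
   straightens A to R^k x {0}; k may depend on the point. *)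
Definition submanifold (R : realType) (n : nat) (A : set 'rV[R]_n) : Prop :=
  forall p, A p -> exists (k : nat) (U : set 'rV[R]_n)
      (phi psi : 'rV[R]_n -> 'rV[R]_n),
    [/\ (k <= n)%N /\ U p,
        open U /\ open (phi @` U),
        C1_on U phi /\ C1_on (phi @` U) psi,
        forall x, U x -> psi (phi x) = x &
        forall x, U x ->
          (A x <-> forall i : 'I_n, (k <= i)%N -> phi x ord0 i = 0)].

Record piecewise_smooth (R : realType) (n m : nat) (g : 'rV[R]_n -> R)
    (Om : 'I_m -> set 'rV[R]_n) : Prop := {
  ps_continuous : continuous g ;
  ps_open : forall j, open (Om j) ;
  ps_disjoint : trivIset [set: 'I_m] Om ;
  ps_cover : \bigcup_j closure (Om j) = [set: 'rV[R]_n] ;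
  ps_C1 : forall j, C1_scalar_on (Om j) g ;
  ps_manifold : forall j, submanifold (boundary (Om j))
}.

(* On the open set Om j the gradient of the restriction of g to closure (Om j)
   is grad g, so that this is the existence of the limits defining it on
   boundary (Om j). *)
Definition gradients_extend (R : realType) (n m : nat) (g : 'rV[R]_n -> R)
    (Om : 'I_m -> set 'rV[R]_n) : Prop :=
  forall j (x : 'rV[R]_n), boundary (Om j) x -> cvg (grad g @ within (Om j) (nbhs x)).

Definition dirderiv (R : realType) (n : nat) (g : 'rV[R]_n -> R)
    (x eta : 'rV[R]_n) : R :=
  lim (d^-1 * (g (x + d *: eta) - g x) @[d --> (0 : R)^'+]).

Record clf_pair (R : realType) (n M m : nat)
    (f : 'I_M -> 'rV[R]_n -> 'rV[R]_n) (V W : 'rV[R]_n -> R)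
    (Om : 'I_m -> set 'rV[R]_n) : Prop := {
  clf_smooth : piecewise_smooth V Om ;
  clf_V_ge0 : forall x, 0 <= V x ;
  clf_W_ge0 : forall x, 0 <= W x ;
  clf_W_continuous : continuous W ;
  clf_V_gt0 : forall x : 'rV[R]_n, x != 0 -> 0 < V x ;
  clf_W_gt0 : forall x : 'rV[R]_n, x != 0 -> 0 < W x ;
  clf_V0 : V 0 = 0 ;
  clf_bounded : forall beta : R, bounded_set [set x | V x <= beta] ;
  clf_decrease : forall x,
    (\big[Order.min/+oo]_(i < M) (dirderiv V x (f i x))%:E <= (- W x)%:E)%E
}.

(* The minimum over an empty index set (M = 1) is +oo. *)
Definition dominance_piece (R : realType) (n M m : nat)
    (f : 'I_M -> 'rV[R]_n -> 'rV[R]_n) (V : 'rV[R]_n -> R)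
    (Om : 'I_m -> set 'rV[R]_n) (j : 'I_m) (i : 'I_M) : set 'rV[R]_n :=
  [set x | Om j x /\
    ((dot (grad V x) (f i x))%:E <
       \big[Order.min/+oo]_(q < M | q != i) (dot (grad V x) (f q x))%:E)%E].

Definition dominance (R : realType) (n M m : nat)
    (f : 'I_M -> 'rV[R]_n -> 'rV[R]_n) (V : 'rV[R]_n -> R)
    (Om : 'I_m -> set 'rV[R]_n) (i : 'I_M) : set 'rV[R]_n :=
  \bigcup_j dominance_piece f V Om j i.

Definition dominance_boundary (R : realType) (n M m : nat)
    (f : 'I_M -> 'rV[R]_n -> 'rV[R]_n) (V : 'rV[R]_n -> R)
    (Om : 'I_m -> set 'rV[R]_n) : set 'rV[R]_n :=
  \bigcup_i boundary (dominance f V Om i).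

(* nu = S[V]; admissibility makes these two clauses determine nu everywhere. *)
Record switching_law (R : realType) (n M m : nat)
    (f : 'I_M -> 'rV[R]_n -> 'rV[R]_n) (V : 'rV[R]_n -> R)
    (Om : 'I_m -> set 'rV[R]_n) (nu : 'rV[R]_n -> 'I_M) : Prop := {
  law_interior : forall x i, dominance f V Om i x -> nu x = i ;
  law_boundary : forall x, dominance_boundary f V Om x ->
    boundary (dominance f V Om (nu x)) x /\
    forall i, boundary (dominance f V Om i) x -> (nu x <= i)%N
}.

Record admissible_law (R : realType) (n M m : nat)
    (f : 'I_M -> 'rV[R]_n -> 'rV[R]_n) (V : 'rV[R]_n -> R)
    (Om : 'I_m -> set 'rV[R]_n) : Prop := {
  adm_cover : \bigcup_i closure (dominance f V Om i) = [set: 'rV[R]_n] ;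
  adm_null : null_set (dominance_boundary f V Om)
}.

Definition closed_loop (R : realType) (n M : nat)
    (f : 'I_M -> 'rV[R]_n -> 'rV[R]_n) (nu : 'rV[R]_n -> 'I_M)
    (x : 'rV[R]_n) : 'rV[R]_n :=
  f (nu x) x.

Definition nonsliding_solutions (R : realType) (n M : nat)
    (f : 'I_M -> 'rV[R]_n -> 'rV[R]_n) (nu : 'rV[R]_n -> 'I_M) (eps : R) :
    set (R -> 'rV[R]_n) :=
  [set x | exists z, [/\ enorm z <= eps,
     filippov_solution (closed_loop f nu) z x &
     {ae (@lebesgue_measure R), forall t : R, 0 <= t ->
        derivable x t 1 /\ derive1 x t = closed_loop f nu (x t)}]].

Definition gas_excluding_sliding (R : realType) (n M : nat)
    (f : 'I_M -> 'rV[R]_n -> 'rV[R]_n) (nu : 'rV[R]_n -> 'I_M) : Prop :=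
  (forall eps : R, 0 < eps -> exists2 delta : R, 0 < delta &
     forall x, nonsliding_solutions f nu delta x ->
       forall t : R, 0 <= t -> enorm (x t) < eps) /\
  (forall (rho : R) x, 0 < rho -> nonsliding_solutions f nu rho x ->
     x t @[t --> +oo] --> (0 : 'rV[R]_n)).

(* Main.v *)
Require Import Defs.
From mathcomp Require Import all_boot all_order all_algebra.
From mathcomp Require Import all_classical all_reals all_analysis.
From mathcomp Require Import measurable_realfun ring lra.
Import Order.TTheory GRing.Theory Num.Theory.
Import numFieldNormedType.Exports.
Local Open Scope classical_set_scope.
Local Open Scope ring_scope.

(** A curve [x] that is not sliding satisfies [x' = f_(nu x)(x)] almost
    everywhere, hence is locally Lipschitz.  In a chart straightening
    [boundary (Om j)] to a linear subspace, a segment joining two points of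
    [Om j] meets the subspace at most once and otherwise stays in [Om j]; so [V]
    is strictly differentiable at every point relative to each piece
    [closure (Om j)] containing it, and [V \o x] is locally Lipschitz.  By
    density of the dominance regions, some piece containing [q] has a limit
    gradient [p] at [q] with [<p, f_(nu q) q> <= - W q].  At a Lebesgue density
    point [t] of the times spent in that piece the derivative of [V \o x] can be
    computed along the piece, so it equals [<p, x' t> <= - W (x t)], even when
    [x t] lies on a boundary.  Thus [V] decreases along [x] at rate [W], and
    Lyapunov's classical argument applies. *)

Set Implicit Arguments.
Unset Strict Implicit.
Unset Printing Implicit Defensive.

(** * Cousin's lemma and increments of curves *)

(** Continuous induction: an interval straddling the supremum of the [s] with [P a s] first reaches
    that supremum and then, unless it is [b], goes past it. It replaces compactness of [[a, b]]
    throughout. *)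
Lemma cousin (R : realType) (P : R -> R -> Prop) (a b : R) :
  a <= b ->
  (forall u v w, a <= u -> u <= v -> v <= w -> w <= b ->
     P u v -> P v w -> P u w) ->
  (forall t, a <= t <= b -> exists2 d, 0 < d &
     forall u w, a <= u -> w <= b -> t - d < u -> u <= t -> t <= w ->
       w < t + d -> P u w) ->
  P a b.
Proof.
move=> ab Ptrans Ploc.
pose S := [set s | a <= s <= b /\ P a s].
have Sa : S a.
  split; first by rewrite lexx.
  have [|d d0] := Ploc a; first by rewrite lexx.
  by apply; rewrite ?lexx// ?ltrBlDr ltrDl.
have ubS : ubound S b by move=> s [/andP[]].
have hS : has_sup S by split; [exists a | exists b].
have supa : a <= sup S by apply: ub_le_sup => //; exists b.
have supb : sup S <= b by apply: ge_sup => //; exists a.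
have [|d d0 Pd] := Ploc (sup S); first by rewrite supa.
have [s [/andP[as_ sb] Ps] ds] := sup_adherent d0 hS.
have ssup : s <= sup S by apply: ub_le_sup; [exists b|split => //; rewrite as_].
pose s' := Num.min b (sup S + d / 2).
have sups' : sup S <= s' by rewrite le_min supb/=; lra.
have s'b : s' <= b by rewrite ge_min lexx.
have s'd : s' < sup S + d by rewrite gt_min; apply/orP; right; lra.
have Ps' : P a s'.
  by apply: (Ptrans a s s') => //; [exact: le_trans sups'|exact: Pd].
have : s' <= sup S.
  apply: ub_le_sup; first by exists b.
  by split=> //; rewrite s'b (le_trans supa).
rewrite /s' ge_min => /orP[bs|]; last by lra.
suff -> : b = s' by [].
by apply/le_anti; rewrite s'b andbT (le_trans bs).
Qed.

Lemma derivable_expansion (R : realType) (E : normedModType R) (g : R -> E)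
    (t : R) (e : R) : derivable g t 1 -> 0 < e ->
  exists2 d, 0 < d & forall s, `|s - t| < d ->
    `|g s - g t - (s - t) *: derive1 g t| <= e * `|s - t|.
Proof.
move=> dg e0; rewrite derive1E.
have /cvgrPdist_le/(_ e e0)[d /= d0 Hd] := dg.
exists d => // s sd; have [->|st] := eqVneq s t.
  by rewrite !subrr scale0r subrr !normr0 mulr0.
have := Hd (s - t); rewrite /= sub0r normrN => /(_ sd).
rewrite subr_eq0 => /(_ st).
rewrite [(s - t)%:A]mulr1 subrK => H.
have st0 : s - t != 0 by rewrite subr_eq0.
have -> : g s - g t - (s - t) *: 'D_1 g t =
    - ((s - t) *: ('D_1 g t - (s - t)^-1 *: (g s - g t))).
  by rewrite scalerBr scalerA divff// scale1r opprB.
rewrite normrN normrZ mulrC ler_wpM2r//.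
Qed.

(** Mean value inequality. Inside the open interval, increments of slope [B + e] chain by Cousin's
    lemma, and continuity reaches the endpoints. Nothing is differentiated there, so that a path can
    be cut at one exceptional parameter. *)
Lemma norm_increment_le (R : realType) (E : normedModType R) (g : R -> E)
    (B a b : R) : a <= b ->
  (forall t, a < t < b -> derivable g t 1 /\ `|derive1 g t| <= B) ->
  {for a, continuous g} -> {for b, continuous g} ->
  `|g b - g a| <= B * (b - a).
Proof.
move=> ab dg ca cb; have [->|aneb] := eqVneq a b.
  by rewrite !subrr normr0 mulr0.
have {aneb}ab : a < b by rewrite lt_neqAle aneb.
have inner e u w : 0 < e -> a < u -> u <= w -> w < b ->
    `|g w - g u| <= (B + e) * (w - u).
  move=> e0 au uw wb.
  apply: (@cousin _ (fun u w => `|g w - g u| <= (B + e) * (w - u)) u w) => //.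
    by move=> p q r _ _ _ _ H1 H2; have := ler_distD (g q) (g r) (g p); lra.
  move=> t /andP[ut tw].
  have [|dgt gB] := dg t; first by apply/andP; split; lra.
  have [d d0 Hd] := derivable_expansion dgt e0.
  exists d => // p r up rw dp pt tr rd.
  have bd s : `|s - t| < d -> `|g s - g t| <= (B + e) * `|s - t|.
    move=> /Hd H; rewrite -(subrK ((s - t) *: derive1 g t) (g s - g t)).
    rewrite (le_trans (ler_normD _ _))// mulrDl addrC lerD// normrZ mulrC.
    by rewrite ler_wpM2r.
  have br : `|g r - g t| <= (B + e) * (r - t).
    by have := bd r; rewrite ger0_norm ?subr_ge0//; apply; lra.
  have bp : `|g t - g p| <= (B + e) * (t - p).
    by have := bd p; rewrite (distrC p) (distrC (g p)) ger0_norm ?subr_ge0//;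
      apply; lra.
  by have := ler_distD (g t) (g r) (g p); lra.
have B0 : 0 <= B.
  have [|_] := dg ((a + b) / 2); first by apply/andP; split; lra.
  by apply: le_trans.
apply/ler_addgt0Pl => e e0.
(* Moving both endpoints inwards by [m] costs at most [c / 2] at each end, and the slope [B + c]
   costs [c * (b - a)] more; [c * k <= e] covers the sum. *)
set k := 1 + (B + 1) * 2 + (b - a).
have k0 : 0 < k by rewrite /k; nra.
have ek0 : 0 < e / k by rewrite divr_gt0.
pose c := Num.min (e / k) 1.
have c0 : 0 < c by rewrite lt_min ek0/=.
have ck : c * k <= e by rewrite -ler_pdivlMr// ge_min lexx.
have c1 : c <= 1 by rewrite ge_min lexx orbT.
have /cvgrPdist_le/(_ (c / 2))[|da /= da0 Ha] := ca; first by rewrite divr_gt0.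
have /cvgrPdist_le/(_ (c / 2))[|db /= db0 Hb] := cb; first by rewrite divr_gt0.
pose m := Num.min (Num.min da db) ((b - a) / 2) / 2.
have m0 : 0 < m by rewrite divr_gt0// !lt_min da0 db0/=; lra.
have mda : m < da.
  have : Num.min (Num.min da db) ((b - a) / 2) <= da by rewrite !ge_min lexx.
  by rewrite /m; lra.
have mdb : m < db.
  have : Num.min (Num.min da db) ((b - a) / 2) <= db.
    by rewrite !ge_min lexx orbT.
  by rewrite /m; lra.
have mab : m < (b - a) / 2.
  have : Num.min (Num.min da db) ((b - a) / 2) <= (b - a) / 2.
    by rewrite !ge_min lexx orbT.
  by rewrite /m; lra.
have H1 : `|g (b - m) - g (a + m)| <= (B + c) * (b - m - (a + m)).
  by apply: inner => //; lra.
have H2 : `|g a - g (a + m)| <= c / 2.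
  by apply: Ha; rewrite /ball_/= opprD addrA subrr sub0r normrN gtr0_norm.
have H3 : `|g b - g (b - m)| <= c / 2.
  by apply: Hb; rewrite /ball_/= opprB addrC subrK gtr0_norm.
have -> : g b - g a = (g b - g (b - m)) + (g (b - m) - g (a + m)) -
    (g a - g (a + m)).
  by rewrite (subrKA (g (b - m))) opprB (subrKA (g (a + m))).
rewrite (le_trans (ler_normB _ _))//.
have := ler_normD (g b - g (b - m)) (g (b - m) - g (a + m)).
rewrite /k in ck; nra.
Qed.

(** * Absolutely continuous functions and density points on the line *)

Definition ac_on (R : realType) (a b : R) (h : R -> R) : Prop :=
  forall e : R, 0 < e -> exists2 d : R, 0 < d &
    forall (k : nat) (u v : 'I_k -> R),
      (forall i, [/\ a <= u i, u i <= v i & v i <= b]) ->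
      trivIset [set: 'I_k] (fun i => `]u i, v i[%classic) ->
      \sum_(i < k) (v i - u i) < d ->
      \sum_(i < k) `|h (v i) - h (u i)| < e.

(** Lets the small measure of an open cover of a null set feed the modulus of absolute
    continuity. *)
Lemma sum_itv_le_measure (R : realType) (k : nat) (u v : 'I_k -> R)
    (G : set R) : measurable G -> (forall i, u i <= v i) ->
  (forall i, `]u i, v i[%classic `<=` G) ->
  trivIset [set: 'I_k] (fun i => `]u i, v i[%classic) ->
  ((\sum_(i < k) (v i - u i))%:E <= lebesgue_measure G)%E.
Proof.
move=> mG uv uvG tuv.
have -> : (\sum_(i < k) (v i - u i))%:E =
    \sum_(i < k | predT i) lebesgue_measure `]u i, v i[%classic.
  rewrite -sumEFin; apply: eq_bigr => i _.
  rewrite lebesgue_measure_itv/= lte_fin; case: ltP => // vu.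
  by congr (_%:E); have := uv i; lra.
rewrite -measure_bigsetU_ord//; apply: le_measure.
- by rewrite inE; apply: bigsetU_measurable => i _; exact: measurable_itv.
- by rewrite inE.
- elim/big_ind : _ => [|A B AG BG|i _]; [exact: sub0set| |exact: uvG].
  by rewrite subUset.
Qed.

(** A nonpositive upper derivative at [t], in straddle form: both endpoints move around [t], which
    is the tag of an interval in a Cousin partition. *)
Definition straddle_le (R : realType) (h : R -> R) (t : R) : Prop :=
  forall e, 0 < e -> exists2 d, 0 < d & forall u w,
    t - d < u -> u <= t -> t <= w -> w < t + d -> h w - h u <= e * (w - u).

(* An open set of small measure covers the exceptional null set; intervals of a
   Cousin partition inside it contribute little by absolute continuity, and
   the others satisfy the straddle estimate. *)
Lemma ac_nonincreasing (R : realType) (a b : R) (h : R -> R) : a <= b ->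
  ac_on a b h ->
  {ae (@lebesgue_measure R), forall t, a < t < b -> straddle_le h t} ->
  h b <= h a.
Proof.
move=> ab ach [A [mA A0 HA]].
apply/ler_addgt0Pl => e e0.
pose e1 := e / 2 / (b - a + 1).
have e10 : 0 < e1 by rewrite !divr_gt0//; lra.
have e1ab : e1 * (b - a) <= e / 2.
  have : e1 * (b - a + 1) = e / 2 by rewrite /e1 divfK// gt_eqF//; lra.
  lra.
have [|d d0 Hd] := ach (e / 2); first by rewrite divr_gt0.
(* The straddle estimate is assumed for [a < t < b] only, so the two endpoints join the exceptional
   set. *)
have [N [mN N0 AN]] : lebesgue_measure.-negligible (A `|` [set a; b]).
  apply: negligibleU; first by apply/negligibleP.
  apply: negligibleU.
    by apply/negligibleP => //; exact: lebesgue_measure_set1.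
  by apply/negligibleP => //; exact: lebesgue_measure_set1.
have N0' : lebesgue_measure N = 0%E by exact: N0.
have Noo : (lebesgue_measure N < +oo)%E by rewrite N0' ltry.
have [G [oG NG Gd]] := lebesgue_regularity_outer mN Noo d0.
have mG : measurable G by exact: open_measurable.
have {}Gd : (lebesgue_measure G < d%:E)%E.
  have GN : lebesgue_measure G = lebesgue_measure (G `\` N).
    rewrite -[in LHS](setDUK NG) setUC.
    by apply: measureU0 => //; exact: measurableD.
  by rewrite GN; exact: Gd.
pose ok u w (s : seq (R * R)) :=
  all (fun p => (u <= p.1) && (p.1 <= p.2) && (p.2 <= w)) s &&
  pairwise (fun p q => p.2 <= q.1) s.
(* The list [s] holds, in increasing order, the partition intervals lying in [G]; their variation is
   kept apart from the slope [e1] that controls the others. *)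
pose P u w := exists s : seq (R * R), [/\ ok u w s,
  forall p, p \in s -> `]p.1, p.2[%classic `<=` G &
  h w - h u <= e1 * (w - u) + \sum_(p <- s) `|h p.2 - h p.1| ].
have [s [/andP[/allP sall spair] sG hs]] : P a b.
  apply: cousin => //.
    move=> u v w _ uv vw _ [s1 [/andP[a1 p1] G1 h1]] [s2 [/andP[a2 p2] G2 h2]].
    exists (s1 ++ s2); split.
    - apply/andP; split.
        rewrite all_cat; apply/andP; split.
          apply: sub_all a1 => p /andP[/andP[-> ->] /le_trans]; exact.
        by apply: sub_all a2 => p /andP[/andP[/(le_trans uv) -> ->] ->].
      rewrite pairwise_cat p1 p2 !andbT; apply/allrelP => p q.
      move=> /(allP a1)/andP[_ pv] /(allP a2)/andP[/andP[vq _] _].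
      exact: le_trans vq.
    - by move=> p; rewrite mem_cat => /orP[/G1|/G2].
    - by rewrite big_cat/=; lra.
  move=> t /andP[at_ tb].
  have [Gt|nGt] := pselect (G t).
    have /nbhs_ballP[r /= r0 tG] : nbhs t G by apply: open_nbhs_nbhs.
    exists r => // u w au wb tru ut tw wtr.
    exists [:: (u, w)]; split => //=.
    - by rewrite /ok/= !lexx (le_trans ut).
    - move=> p; rewrite inE => /eqP -> y /=; rewrite in_itv/= => /andP[uy yw].
      by apply: tG; rewrite /ball/= ltr_distlC; apply/andP; split; lra.
    - rewrite big_seq1/= (le_trans (ler_norm _))// ler_wpDl//.
      by rewrite mulr_ge0 ?(ltW e10)// subr_ge0 (le_trans ut).
  have nt : ~ (A `|` [set a; b]) t by move=> /AN/NG.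
  have tab : a < t < b.
    rewrite !lt_neqAle at_ tb !andbT; apply/andP; split; apply/eqP => tt.
      by apply: nt; right; left.
    by apply: nt; right; right.
  have /contrapT/(_ tab)/(_ e1 e10)[r r0 Hr] :
      ~ ~ (a < t < b -> straddle_le h t).
    by move=> /HA At; apply: nt; left.
  exists r => // u w au wb tru ut tw wtr.
  exists [::]; split => //; rewrite big_nil addr0; exact: Hr.
pose T := in_tuple s.
have Ts (i : 'I_(size s)) : tnth T i \in s by exact: mem_tnth.
have Tab i : [/\ a <= (tnth T i).1, (tnth T i).1 <= (tnth T i).2 &
    (tnth T i).2 <= b].
  by have /sall/andP[/andP[]] := Ts i.
have Ttriv : trivIset [set: 'I_(size s)]
    (fun i => `](tnth T i).1, (tnth T i).2[%classic).
  have ord (i j : 'I_(size s)) : (i < j)%N -> (tnth T i).2 <= (tnth T j).1.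
    move=> ij; rewrite !(tnth_nth (0, 0))/=.
    by move/(pairwiseP (0, 0)) : spair; apply; rewrite ?inE.
  move=> i j _ _ [y []] /=; rewrite !in_itv/= => /andP[iy yi] /andP[jy yj].
  apply/val_inj/eqP; case: ltngtP => // /ord; lra.
have sumE (F : R * R -> R) : \sum_(p <- s) F p = \sum_(i < size s) F (tnth T i).
  exact: (big_tuple _ _ T predT F).
have lts : \sum_(i < size s) ((tnth T i).2 - (tnth T i).1) < d.
  rewrite -lte_fin (le_lt_trans _ Gd)// sum_itv_le_measure//.
  - by move=> i; have [] := Tab i.
  - by move=> i; exact/sG/Ts.
have := Hd _ _ _ Tab Ttriv lts.
by rewrite -(sumE (fun p => `|h p.2 - h p.1|)); lra.
Qed.

(** If [A] missed the ball of radius [e * r0] around [s], where [r0] is the distance from [s] to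
    [t], it would miss the proportion [e / (1 + e)] of the ball of radius [(1 + e) * r0] around [t].
    This contradicts density 1 at [t] for small [r0]. *)
Lemma lebesgue_density_dense (R : realType) (A : set R) : closed A ->
  {ae (@lebesgue_measure R), forall t, A t -> forall e, 0 < e ->
    exists2 d, 0 < d & forall s, `|s - t| < d ->
      exists2 s', A s' & `|s' - s| <= e * `|s - t|}.
Proof.
move=> cA; have mA := closed_measurable cA.
have := lebesgue_density mA.
apply: (filterS
  (Filter := ae_filter_ringOfSetsType (@lebesgue_measure R))) => t.
have [At|//] := pselect (A t).
rewrite indicE mem_set//= => /fine_cvgP[_ dens] _ e e0.
have c0 : 0 < e / (1 + e) by rewrite divr_gt0//; lra.
have /cvgrPdist_lt/(_ _ c0)[d /= d0 Hd] := dens.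
have d1 : 0 < d / (1 + e) by rewrite divr_gt0//; lra.
exists (d / (1 + e)) => // s std.
have [->|st] := eqVneq s t.
  by exists t => //; rewrite !subrr normr0 mulr0.
set r0 := `|s - t| in std *.
have r00 : 0 < r0 by rewrite normr_gt0 subr_eq0.
apply: contrapT => nA.
have rd : (1 + e) * r0 < d by rewrite mulrC -ltr_pdivlMr//; lra.
have rr0 : 0 < (1 + e) * r0 by nra.
have := Hd ((1 + e) * r0); rewrite /ball_ /= sub0r normrN gtr0_norm//.
move=> /(_ rd rr0).
set X := lebesgue_measure (A `&` ball t ((1 + e) * r0)).
have mBt : measurable (ball t ((1 + e) * r0)) by exact: measurable_ball.
have mBs : measurable (ball s (e * r0)) by exact: measurable_ball.
have mAB : measurable (A `&` ball t ((1 + e) * r0)) by exact: measurableI.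
have XB : (X + (e * r0 *+ 2)%:E <= ((1 + e) * r0 *+ 2)%:E)%E.
  rewrite -(@lebesgue_measure_ball R s (e * r0)); last by nra.
  rewrite -(@lebesgue_measure_ball R t ((1 + e) * r0)); last by nra.
  rewrite -measureU//; last first.
    apply/seteqP; split => // y [[Ay _]]; rewrite /ball/= => sy.
    by apply: nA; exists y => //; rewrite distrC ltW.
  apply: le_measure; rewrite ?inE//; first exact: measurableU.
  rewrite subUset; split; first exact: subIsetr.
  move=> y; rewrite /ball/= => sy.
  have := ler_distD s t y; rewrite (distrC t s) -/r0; nra.
have X0 : (0 <= X)%E by exact: measure_ge0.
have Xfin : X \is a fin_num.
  rewrite ge0_fin_numE// (le_lt_trans _ (ltry ((1 + e) * r0 *+ 2)))//.
  by rewrite (le_trans _ XB)// leeDl// lee_fin; nra.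
rewrite lebesgue_measure_ball; last by nra.
move: XB X0; rewrite -(fineK Xfin) -EFinD !lee_fin; set x := fine X => xB x0.
rewrite inver gt_eqF; last by nra.
rewrite -EFinM/= => /(le_lt_trans (ler_norm _)).
apply/negP; rewrite -leNgt.
have k0 : 0 < (1 + e) * r0 *+ 2 by nra.
have -> : e / (1 + e) = (e * r0 *+ 2) / ((1 + e) * r0 *+ 2).
  by field; apply/andP; split; apply: lt0r_neq0; lra.
rewrite lerBrDr -mulrDl ler_pdivrMr// mul1r; lra.
Qed.

(** * Strict differentiability relative to a piece *)

Lemma continuous_atP (R : realFieldType) (E F : normedModType R) (g : E -> F)
    (x : E) : {for x, continuous g} <->
  forall e, 0 < e -> exists2 d, 0 < d & forall y, `|y - x| < d ->
    `|g y - g x| <= e.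
Proof.
split=> [cg e e0|H].
  have /(@cvgrPdist_le _ _ _ (nbhs x))/(_ e e0)/nbhs_ballP[d /= d0 Hd] := cg.
  exists d => // y xy; rewrite distrC; apply: Hd.
  by rewrite -ball_normE/= distrC.
apply/(@cvgrPdist_le _ _ _ (nbhs x)) => e /H[d d0 Hd].
apply/nbhs_ballP; exists d => // y; rewrite -ball_normE/= distrC => /Hd.
by rewrite distrC.
Qed.

(** * Dot products, gradients and the chain rule *)

Section dot_theory.
Context {R : realType} {n : nat}.
Implicit Types (p u v x : 'rV[R]_n).

Lemma row_entry_le v i : `|v ord0 i| <= `|v|.
Proof.
rewrite [leRHS]/Num.Def.normr/= mx_normrE.
exact: (le_bigmax _ (fun i : 'I_1 * 'I_n => `|v i.1 i.2|) (ord0, i)).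
Qed.

Lemma row_norm_le v B : 0 <= B -> (forall i, `|v ord0 i| <= B) -> `|v| <= B.
Proof.
move=> B0 vB; rewrite /Num.Def.normr/= mx_normrE.
by apply: bigmax_le => //= -[i j] _; rewrite (ord1 i) vB.
Qed.

Lemma dotDr p u v : dot p (u + v) = dot p u + dot p v.
Proof. by rewrite -big_split/=; apply: eq_bigr => i _; rewrite mxE mulrDr. Qed.

Lemma dotZr p a u : dot p (a *: u) = a * dot p u.
Proof. by rewrite mulr_sumr; apply: eq_bigr => i _; rewrite mxE mulrCA. Qed.

Lemma dotC u v : dot u v = dot v u.
Proof. by apply: eq_bigr => i _; rewrite mulrC. Qed.

Lemma dotBr p u v : dot p (u - v) = dot p u - dot p v.
Proof. by rewrite dotDr -scaleN1r dotZr mulN1r. Qed.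

Lemma dotBl p u v : dot (u - v) p = dot u p - dot v p.
Proof. by rewrite !(dotC _ p) dotBr. Qed.

(** The factor [n] is the price of the max norm; it enters the constants named [N] below. *)
Lemma norm_dot_le u v : `|dot u v| <= n%:R * `|u| * `|v|.
Proof.
rewrite (le_trans (ler_norm_sum _ _ _))// -mulrA mulr_natl.
rewrite -[X in _ *+ X]card_ord -sumr_const; apply: ler_sum => i _.
by rewrite normrM ler_pM// row_entry_le.
Qed.

Lemma norm_mulmx_le v (A : 'M[R]_n) : `|v *m A| <= n%:R * `|A| * `|v|.
Proof.
apply: row_norm_le => [|j]; first by rewrite !mulr_ge0.
rewrite mxE (le_trans (ler_norm_sum _ _ _))// -mulrA mulr_natl.
rewrite -[X in _ *+ X]card_ord -sumr_const; apply: ler_sum => i _.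
rewrite normrM mulrC ler_pM// ?row_entry_le//.
rewrite [leRHS]/Num.Def.normr/= mx_normrE.
exact: (le_bigmax _ (fun i : 'I_n * 'I_n => `|A i.1 i.2|) (i, j)).
Qed.

Lemma dot_continuous p : continuous (dot p).
Proof.
move=> x; apply/continuous_atP => e e0.
pose k : R := n%:R * `|p| + 1.
have k0 : 0 < k by rewrite ltr_wpDl ?mulr_ge0.
exists (e / k) => [|y]; first exact: divr_gt0.
rewrite ltr_pdivlMr// => /ltW xy.
rewrite -dotBr (le_trans (norm_dot_le _ _))// (le_trans _ xy)// mulrC.
by rewrite ler_wpM2l// /k lerDl.
Qed.

Lemma diff_dot_grad (g : 'rV[R]_n -> R) x v : differentiable g x ->
  'd g x v = dot (grad g x) v.
Proof.
move=> dg; rewrite {1}(row_sum_delta v) linear_sum; apply: eq_bigr => i _.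
by rewrite linearZ/= mxE -deriveE// mulrC.
Qed.

End dot_theory.

Lemma derive1_dot (R : realType) (n : nat) (p : 'rV[R]_n) (g : R -> 'rV[R]_n)
    (t : R) : derivable g t 1 ->
  derivable (dot p \o g) t 1 /\ derive1 (dot p \o g) t = dot p (derive1 g t).
Proof.
rewrite derive1E => dg.
suff H : h^-1 *: ((dot p \o g) (h *: 1 + t) - (dot p \o g) t) @[h --> 0^'] -->
    dot p ('D_1 g t).
  split; first by apply/cvg_ex; exists (dot p ('D_1 g t)).
  by rewrite derive1E; apply/cvg_lim.
under eq_fun do rewrite /= -dotBr -[_ *: _]dotZr.
exact: (cvg_comp _ _ dg (@dot_continuous R n p _)).
Qed.

Lemma derive1_chain (R : realType) (n : nat) (V : 'rV[R]_n -> R)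
    (g : R -> 'rV[R]_n) (t : R) :
  derivable g t 1 -> differentiable V (g t) ->
  derivable (V \o g) t 1 /\
  derive1 (V \o g) t = dot (grad V (g t)) (derive1 g t).
Proof.
move=> /derivable1_diffP dg dV.
have dVg : differentiable (V \o g) t by exact: differentiable_comp.
split; first by apply/derivable1_diffP.
by rewrite derive1E'// diff_comp//= diff_dot_grad// derive1E'.
Qed.

Lemma derive1_line (R : realType) (n m : nat) (f : 'rV[R]_n -> 'rV[R]_m)
    (a v : 'rV[R]_n) (s : R) : differentiable f (a + s *: v) ->
  derivable (fun s : R => f (a + s *: v)) s 1 /\
  derive1 (fun s : R => f (a + s *: v)) s = v *m jacobian f (a + s *: v).
Proof.
move=> df; rewrite -deriveEjacobian// derive1E /derivable /derive.
have -> : (fun h : R => h^-1 *: (f (a + (h%:A + s) *: v) - f (a + s *: v))) =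
    (fun h => h^-1 *: (f (h *: v + (a + s *: v)) - f (a + s *: v))).
  apply/funext => h; congr (_ *: (f _ - _)).
  by rewrite [h%:A]mulr1 scalerDl addrCA.
split => //; exact: diff_derivable.
Qed.

(** * Segments, charts and paths that stay in a piece *)

Lemma segment_ball (R : realType) (E : normedModType R) (x y z : E) (r s : R) :
  `|y - x| < r -> `|z - x| < r -> 0 <= s <= 1 ->
  `|y + s *: (z - y) - x| < r.
Proof.
move=> yr zr /andP[s0 s1].
have -> : y + s *: (z - y) - x = (1 - s) *: (y - x) + s *: (z - x).
  rewrite scalerBl scale1r -[RHS]addrA (addrC (- _)) -scalerBr opprB addrA.
  by rewrite subrK addrAC.
have s1' : 0 <= 1 - s by rewrite subr_ge0.
rewrite (le_lt_trans (ler_normD _ _))// !normrZ !ger0_norm//.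
have [->|sn0] := eqVneq s 0; first by rewrite subr0 mul1r mul0r addr0.
have sp : 0 < s by rewrite lt_def sn0.
have : s * `|z - x| < s * r by rewrite ltr_pM2l.
have : (1 - s) * `|y - x| <= (1 - s) * r by rewrite ler_wpM2l// ltW.
lra.
Qed.

Lemma C1_on_ball (R : realType) (n : nat) (U : set 'rV[R]_n)
    (phi : 'rV[R]_n -> 'rV[R]_n) (x : 'rV[R]_n) :
  open U -> C1_on U phi -> U x -> exists K r : R, [/\ 0 <= K, 0 < r &
    forall y, `|y - x| < r -> [/\ U y, differentiable phi y &
      forall v : 'rV[R]_n, `|v *m jacobian phi y| <= K * `|v|]].
Proof.
move=> oU C1 Ux; have [_ /continuous_atP cJ] := C1 _ Ux.
have [d d0 Hd] := cJ 1 ltr01.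
have /nbhs_ballP[r /= r0 rU] : nbhs x U by exact: open_nbhs_nbhs.
(* The bound comes from [norm_mulmx_le], the Jacobian staying within 1 of its value at [x]. *)
exists (n%:R * (`|jacobian phi x| + 1)), (Num.min r d); split.
- by rewrite mulr_ge0// addr_ge0.
- by rewrite lt_min r0.
- move=> y; rewrite lt_min => /andP[yr yd].
  have Uy : U y by apply: rU; rewrite -ball_normE/= distrC.
  split=> //; first by have [] := C1 _ Uy.
  move=> v; rewrite (le_trans (norm_mulmx_le _ _))// ler_wpM2r// ler_wpM2l//.
  rewrite -[jacobian phi y](subrK (jacobian phi x)).
  by rewrite (le_trans (ler_normD _ _))// addrC lerD// Hd.
Qed.

Lemma C1_on_lipschitz (R : realType) (n : nat) (U : set 'rV[R]_n)
    (phi : 'rV[R]_n -> 'rV[R]_n) (x : 'rV[R]_n) :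
  open U -> C1_on U phi -> U x -> exists K r : R, [/\ 0 <= K, 0 < r &
    forall y z, `|y - x| < r -> `|z - x| < r ->
      `|phi z - phi y| <= K * `|z - y|].
Proof.
move=> oU C1 Ux; have [K [r [K0 r0 H]]] := C1_on_ball oU C1 Ux.
exists K, r; split => // y z yr zr.
pose g (s : R) := phi (y + s *: (z - y)).
have dg s : 0 <= s <= 1 -> derivable g s 1 /\ `|derive1 g s| <= K * `|z - y|.
  move=> s01; have [_ dphi phiK] := H _ (segment_ball yr zr s01).
  by have [dgs ->] := derive1_line dphi.
have cg s : 0 <= s <= 1 -> {for s, continuous g}.
  by move=> /dg[/derivable1_diffP dgs _]; exact: differentiable_continuous.
have := @norm_increment_le R _ g (K * `|z - y|) 0 1 ler01.
rewrite subr0 mulr1 /g scale1r scale0r addr0 (addrC y) subrK; apply.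
- by move=> t /andP[t0 t1]; apply: dg; rewrite !ltW.
- by apply: cg; rewrite lexx/=.
- by apply: cg; rewrite lexx andbT.
Qed.

(** Off its boundary, membership in an open set is locally constant along a path; Cousin's lemma
    makes it constant. *)
Lemma path_avoiding_boundary (R : realType) (E : normedModType R)
    (Om : set E) (g : R -> E) (a b : R) : a <= b -> open Om ->
  (forall s, a <= s <= b -> {for s, continuous g} /\ ~ boundary Om (g s)) ->
  (Om (g a) <-> Om (g b)).
Proof.
move=> ab oOm H; apply: (@cousin _ (fun u w => Om (g u) <-> Om (g w))) => //.
  by move=> u v w _ _ _ _ -> ->.
move=> t /H[cg nb].
have [Ot|nOt] := pselect (Om (g t)).
  have /cg/nbhs_ballP[d /= d0 Hd] : nbhs (g t) Om by exact: open_nbhs_nbhs.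
  exists d => // u w _ _ tu ut tw wt.
  have Hd' s : `|t - s| < d -> Om (g s) by move=> ts; apply: Hd.
  by split=> _; apply: Hd'; rewrite ltr_distlC; apply/andP; split; lra.
have : nbhs (g t) (~` closure Om).
  apply: open_nbhs_nbhs; split; first exact/closed_openC/closed_closure.
  by move=> cOt; apply: nb; split => //; rewrite ((interior_id Om).1 oOm).
move=> /cg/nbhs_ballP[d /= d0 Hd].
exists d => // u w _ _ tu ut tw wt.
have Hd' s : `|t - s| < d -> ~ Om (g s).
  by move=> ts Os; apply: (Hd s) => //; exact: subset_closure.
by split=> Os; exfalso; apply: Hd' Os; rewrite ltr_distlC; apply/andP;
  split; lra.
Qed.

(* The exceptional parameter [s0] lets the curve cross [boundary Om] once, as it
   must when [Om] lies on both sides of a hypersurface. *)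
Definition quasiconvex_at (R : realType) (n : nat) (Om : set 'rV[R]_n)
    (x : 'rV[R]_n) : Prop :=
  exists2 K : R, 0 <= K & forall rho, 0 < rho -> exists2 r, 0 < r &
    forall y z, Om y -> Om z -> `|y - x| < r -> `|z - x| < r ->
    exists (g : R -> 'rV[R]_n) (s0 : R), [/\ g 0 = y, g 1 = z,
      forall s, 0 <= s <= 1 -> {for s, continuous g} &
      forall s, 0 <= s <= 1 -> s != s0 -> [/\ Om (g s), `|g s - x| < rho,
        derivable g s 1 & `|derive1 g s| <= K * `|z - y|]].

Lemma quasiconvex_interior (R : realType) (n : nat) (Om : set 'rV[R]_n)
    (x : 'rV[R]_n) : open Om -> Om x -> quasiconvex_at Om x.
Proof.
move=> oOm Ox; exists 1 => // rho rho0.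
have /nbhs_ballP[r /= r0 rO] : nbhs x Om by exact: open_nbhs_nbhs.
exists (Num.min r rho) => [|y z Oy Oz yr zr]; first by rewrite lt_min r0.
pose g (s : R) : 'rV[R]_n := y + s *: (z - y).
have dg s : derivable g s 1 /\ derive1 g s = z - y.
  have [|dgs ->] := @derive1_line R n n id y (z - y) s; first exact: ex_diff.
  by split => //; rewrite -deriveEjacobian ?derive_id//; exact: ex_diff.
(* The whole segment lies in [Om], so the exceptional parameter is put outside [[0, 1]]. *)
exists g, 2; split.
- by rewrite /g scale0r addr0.
- by rewrite /g scale1r addrC subrK.
- move=> s _; have [/derivable1_diffP dgs _] := dg s.
  exact: differentiable_continuous.
- move=> s s01 _; have := segment_ball yr zr s01.
  rewrite lt_min => /andP[gr grho].
  have [dgs ->] := dg s; split => //; last by rewrite mul1r.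
  by apply: rO; rewrite -ball_normE/= distrC.
Qed.

(** The path is the image under [psi] of the segment from [phi y] to [phi z]. Its speed is
    controlled by the constants of the chart, and it can leave [Om] only through the boundary, hence
    only at the single parameter [s0]. *)
Lemma quasiconvex_boundary (R : realType) (n : nat) (Om : set 'rV[R]_n)
    (x : 'rV[R]_n) : open Om -> submanifold (boundary Om) ->
  boundary Om x -> quasiconvex_at Om x.
Proof.
move=> oOm sub bx.
have [k [U [phi [psi [[_ Ux] [oU oV] [C1phi C1psi] phiK flat]]]]] := sub _ bx.
have [K1 [r1 [K10 r10 H1]]] := C1_on_lipschitz oU C1phi Ux.
have Vx : (phi @` U) (phi x) by exists x.
have [K2 [r2 [K20 r20 H2]]] := C1_on_ball oV C1psi Vx.
have /nbhs_ballP[r3 /= r30 r3U] : nbhs x U by exact: open_nbhs_nbhs.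
exists (K2 * K1) => [|rho rho0]; first exact: mulr_ge0.
have [dpsi _] := C1psi _ Vx.
have rho2 : 0 < rho / 2 by rewrite divr_gt0.
have [d d0 Hd] := (continuous_atP _ _).1 (differentiable_continuous dpsi)
  _ rho2.
pose q := Num.min r2 d.
have q0 : 0 < q by rewrite lt_min r20.
(* Within [r] of [x], chart images lie within [q] of [phi x]; on that ball [psi] has a bounded
   Jacobian and values within [rho / 2] of [x]. *)
pose r := Num.min (Num.min r1 r3) (q / (K1 + 1)).
have K11 : 0 < K1 + 1 by rewrite ltr_wpDl.
have r0 : 0 < r by rewrite !lt_min r10 r30 divr_gt0.
exists r => // y z Oy Oz; rewrite !lt_min => /andP[/andP[y1 y3] yq].
move=> /andP[/andP[z1 z3] zq].
have x1 : `|x - x| < r1 by rewrite subrr normr0.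
have phiq w : `|w - x| < r1 -> `|w - x| < q / (K1 + 1) ->
    `|phi w - phi x| < q.
  move=> w1; rewrite ltr_pdivlMr// mulrC; apply: le_lt_trans.
  by rewrite (le_trans (H1 _ _ x1 w1))// ler_wpM2r// lerDl.
have yphi := phiq _ y1 yq; have zphi := phiq _ z1 zq.
have inU w : `|w - x| < r3 -> U w.
  by move=> wr; apply: r3U; rewrite -ball_normE/= distrC.
have Uy := inU _ y3; have Uz := inU _ z3.
have offb w : Om w -> ~ boundary Om w.
  by move=> Ow [_]; rewrite ((interior_id Om).1 oOm).
pose w (s : R) := phi y + s *: (phi z - phi y).
pose g (s : R) := psi (w s).
have wq s : 0 <= s <= 1 -> `|w s - phi x| < q by exact: segment_ball.
have dg s : 0 <= s <= 1 ->
    derivable g s 1 /\ `|derive1 g s| <= K2 * K1 * `|z - y|.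
  move=> /wq; rewrite lt_min => /andP[wr2 _].
  have [_ dpsis psiK] := H2 _ wr2.
  have [dgs ->] := derive1_line dpsis; split => //.
  by rewrite (le_trans (psiK _))// -mulrA ler_wpM2l// H1.
have cg s : 0 <= s <= 1 -> {for s, continuous g}.
  by move=> /dg[/derivable1_diffP dgs _]; exact: differentiable_continuous.
(* [Om] avoids its boundary, so the endpoints are off the flattened subspace;
   the coordinate [i] alone shows that the segment meets it at most once. *)
have [i [ki phiy]] : exists i : 'I_n, (k <= i)%N /\ phi y ord0 i != 0.
  apply: contrapT => /forallNP H; apply: (offb _ Oy).
  apply/(flat _ Uy) => i ki; apply/eqP/negPn/negP => phiy.
  by apply: (H i).
(* The zero of the affine coordinate [i] along [w]. If that coordinate is constant, the quotient is
   0 by convention; excluding this parameter is harmless, as the coordinate then never vanishes. *)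
pose s0 := phi y ord0 i / (phi y ord0 i - phi z ord0 i).
have offbw s : 0 <= s <= 1 -> s != s0 -> ~ boundary Om (g s).
  move=> s01 ss0.
  have [u Uu uw] : (phi @` U) (w s).
    by have := wq _ s01; rewrite lt_min => /andP[/H2[]].
  rewrite /g -uw phiK// => /(flat _ Uu)/(_ i ki).
  rewrite uw !mxE => e0; move/eqP: ss0; apply.
  rewrite /s0; apply: (canRL (mulfK _)); last by lra.
  by apply: contra phiy => /eqP e1; rewrite -e1; apply/eqP; nra.
have g0 : g 0 = y by rewrite /g /w scale0r addr0 phiK.
have g1 : g 1 = z by rewrite /g /w scale1r addrC subrK phiK.
exists g, s0; split => // s s01 ss0.
have [dgs gs] := dg _ s01; split => //.
  (* Before [s0] the path is tied to [y], after [s0] to [z], and both lie in [Om]; this works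
     whether or not [Om] lies on both sides of its boundary. *)
  have path a b : 0 <= a -> a <= b -> b <= 1 -> (b < s0) || (s0 < a) ->
      (Om (g a) <-> Om (g b)).
    move=> a0 ab b1 abs0; apply: path_avoiding_boundary => // t /andP[a_t tb].
    have t01 : 0 <= t <= 1 by rewrite (le_trans a0)//= (le_trans tb).
    split; first exact: cg.
    by apply: offbw => //; apply/eqP => ts0; move: abs0; rewrite -ts0; lra.
  case/andP: (s01) => s_0 s_1.
  have [lts|] := ltP s s0; first by apply/(path 0 s); rewrite ?g0 ?lts.
  rewrite le_eqVlt eq_sym (negbTE ss0)/= => lts.
  by apply/(path s 1); rewrite ?g1 ?lts ?orbT.
have : `|w s - phi x| < d by have := wq _ s01; rewrite lt_min => /andP[].
by move=> /Hd; rewrite /g phiK//; lra.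
Qed.

(** Both points move, so that [V] gets a local Lipschitz constant on [C] and not only an expansion
    at [q]. *)
Definition strict_gradient (R : realType) (n : nat) (C : set 'rV[R]_n)
    (V : 'rV[R]_n -> R) (q p : 'rV[R]_n) : Prop :=
  forall e, 0 < e -> exists2 r, 0 < r & forall y z,
    C y -> C z -> `|y - q| < r -> `|z - q| < r ->
    `|V z - V y - dot p (z - y)| <= e * `|z - y|.

(** Along a path given by quasiconvexity, [V] minus the linear form of [p] has derivative at most
    [e] times the distance of the endpoints, because [grad V] is close to [p]. The mean value
    inequality applies on each side of [s0], and continuity extends the estimate to the closure. *)
Lemma strict_differentiability (R : realType) (n : nat) (V : 'rV[R]_n -> R)
    (Om : set 'rV[R]_n) (x p : 'rV[R]_n) :
  continuous V -> (forall y, Om y -> differentiable V y) ->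
  quasiconvex_at Om x -> grad V @ within Om (nbhs x) --> p ->
  strict_gradient (closure Om) V x p.
Proof.
move=> cV dV [K K0 qc] gp e e0.
pose N : R := n%:R.
have N0 : 0 <= N by rewrite /N.
(* [N] comes from [norm_dot_le] and [K] from the speed of the path; the added ones keep the divisor
   positive. *)
pose e1 := e / ((N + 1) * (K + 1)).
have NK0 : 0 < (N + 1) * (K + 1) by rewrite mulr_gt0//; lra.
have e10 : 0 < e1 by rewrite divr_gt0.
have e1K : N * e1 * K <= e.
  have : e1 * ((N + 1) * (K + 1)) = e by rewrite /e1 divfK// gt_eqF.
  have : 0 <= e1 * N by nra.
  have : 0 <= e1 * K by nra.
  by lra.
have [rho rho0 Hrho] : exists2 rho, 0 < rho & forall y, `|y - x| < rho ->
    Om y -> `|grad V y - p| <= e1.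
  have /(@cvgrPdist_le _ _ _ (within Om (nbhs x)))/(_ e1 e10) := gp.
  move=> /nbhs_ballP[d /= d0 Hd].
  exists d => // y yd Oy; rewrite distrC; apply: Hd => //.
  by rewrite -ball_normE/= distrC.
have [r r0 Hr] := qc _ rho0.
exists r => //.
have inner y z : Om y -> Om z -> `|y - x| < r -> `|z - x| < r ->
    `|V z - V y - dot p (z - y)| <= e * `|z - y|.
  move=> Oy Oz yr zr; have [g [s0 [g0 g1 cg dg]]] := Hr _ _ Oy Oz yr zr.
  pose h s := V (g s) - dot p (g s).
  have ch s : 0 <= s <= 1 -> {for s, continuous h}.
    move=> s01; apply: continuousB.
      by apply: continuous_comp; [exact: cg|exact: cV].
    by apply: continuous_comp; [exact: cg|exact: dot_continuous].
  have dh s : 0 <= s <= 1 -> s != s0 ->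
      derivable h s 1 /\ `|derive1 h s| <= e * `|z - y|.
    move=> s01 ss0; have [Og grho dgs gK] := dg _ s01 ss0.
    have [d1 e1'] := derive1_chain dgs (dV _ Og).
    have [d2 e2'] := derive1_dot p dgs.
    split; first exact: derivableB.
    rewrite derive1E deriveB// -!derive1E e1' e2' -dotBl.
    rewrite (le_trans (norm_dot_le _ _))//.
    rewrite (le_trans (ler_wpM2r _ (ler_wpM2l _ (Hrho _ grho Og))))//.
    rewrite (le_trans (ler_wpM2l _ gK))//; first by rewrite mulr_ge0 ?(ltW e10).
    by rewrite mulrA ler_wpM2r.
  (* [s0] clamped to [[0, 1]]: neither open subinterval cut off by [c] contains [s0]. *)
  pose c := Num.max 0 (Num.min 1 s0).
  have c0 : 0 <= c by rewrite le_max lexx.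
  have c1 : c <= 1 by rewrite ge_max ler01 ge_min lexx.
  have cs s : 0 < s < c -> s != s0.
    move=> /andP[s_0]; rewrite lt_max !lt_min ltNge (ltW s_0)/= => /andP[_ ss].
    by rewrite lt_eqF.
  have cs' s : c < s < 1 -> s != s0.
    rewrite gt_max !gt_min => /andP[/andP[_ /orP[/lt_trans H /H|ss _]]].
      by rewrite ltxx.
    by rewrite gt_eqF.
  have i1 : `|h c - h 0| <= e * `|z - y| * (c - 0).
    apply: norm_increment_le => //; last 2 first.
    - by apply: ch; rewrite lexx ler01.
    - by apply: ch; rewrite c0.
    move=> t /[dup] /cs ts0 /andP[t0 tc]; apply: dh => //.
    by rewrite ltW// (le_trans (ltW tc)).
  have i2 : `|h 1 - h c| <= e * `|z - y| * (1 - c).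
    apply: norm_increment_le => //; last 2 first.
    - by apply: ch; rewrite c0.
    - by apply: ch; rewrite lexx ler01.
    move=> t /[dup] /cs' ts0 /andP[ct t1]; apply: dh => //.
    by rewrite (ltW t1) andbT (le_trans c0)// ltW.
  have -> : V z - V y - dot p (z - y) = h 1 - h 0.
    by rewrite /h g0 g1 dotBr; ring.
  by have := ler_distD (h c) (h 1) (h 0); lra.
move=> y z cy cz yr zr; apply/ler_addgt0Pl => eta eta0.
(* Errors of replacing [y] and [z] by nearby points of [Om]: two values of [V], the distance of the
   points, and two values of the linear form. *)
pose k := 2 + 2 * e + 2 * (N * `|p|).
have Np0 : 0 <= N * `|p| by exact: mulr_ge0.
have k0 : 0 < k by rewrite /k; lra.
have ek0 : 0 < eta / k by exact: divr_gt0.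
have approx w : closure Om w -> `|w - x| < r -> exists w', [/\ Om w',
    `|w' - x| < r, `|V w' - V w| <= eta / k & `|w' - w| <= eta / k].
  move=> cw wr; have [d d0 Hd] := (continuous_atP _ _).1 (cV w) _ ek0.
  pose b := Num.min (Num.min d (eta / k)) (r - `|w - x|).
  have b0 : 0 < b by rewrite !lt_min d0 ek0/= subr_gt0.
  have [w' [Ow']] := cw _ (nbhsx_ballx w _ b0).
  rewrite -ball_normE/= !lt_min distrC => /andP[/andP[w'd w'e] w'r].
  exists w'; split => //; last exact: ltW.
    by have := ler_distD w w' x; lra.
  exact: Hd.
have [y' [Oy' y'r Vy' yy']] := approx _ cy yr.
have [z' [Oz' z'r Vz' zz']] := approx _ cz zr.
have := inner _ _ Oy' Oz' y'r z'r.
have dot_le u : `|u| <= eta / k -> `|dot p u| <= N * `|p| * (eta / k).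
  by move=> ue; rewrite (le_trans (norm_dot_le _ _))// ler_wpM2l// mulr_ge0.
have := dot_le _ yy'; have := dot_le _ zz'.
rewrite !dotBr.
have : `|z' - y'| <= `|z - y| + 2 * (eta / k).
  have := ler_distD y z' y'; have := ler_distD z z' y.
  by rewrite (distrC y y'); lra.
move=> /(ler_wpM2l (ltW e0)).
have keta : 2 * (eta / k) + 2 * e * (eta / k) + 2 * (N * `|p|) * (eta / k) =
    eta.
  by rewrite -!mulrDl -/k mulrC divfK// gt_eqF.
move: Vy' Vz' keta; set t := eta / k; set Np := N * `|p|.
rewrite !ler_norml; lra.
Qed.

(** * Descent along a curve *)

Lemma uniform_radius (R : realType) (m : nat) (P : 'I_m -> R -> Prop) :
  (forall j r r', r' <= r -> P j r -> P j r') ->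
  (forall j, exists2 r, 0 < r & P j r) -> exists2 r, 0 < r & forall j, P j r.
Proof.
move=> Pmono /(_ _)/cid2-/all_sig2[r r0 Pr].
exists (\big[Num.min/1]_j r j) => [|j]; first by apply: lt_bigmin.
by apply: Pmono (Pr j); exact: bigmin_le.
Qed.

Lemma row_entry_le_enorm (R : realType) (n : nat) (u : 'rV[R]_n) i :
  `|u ord0 i| <= enorm u.
Proof.
rewrite -sqrtr_sqr ler_wsqrtr// /dot (bigD1 i)//= -expr2 lerDl.
by apply: sumr_ge0 => k _; exact: sqr_ge0.
Qed.

Lemma row_norm_le_enorm (R : realType) (n : nat) (u : 'rV[R]_n) :
  `|u| <= enorm u.
Proof.
by apply: row_norm_le => [|i]; rewrite ?sqrtr_ge0 ?row_entry_le_enorm.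
Qed.

Lemma lipschitz_ac (R : realType) (a b L : R) (h : R -> R) : 0 <= L ->
  (forall u v, a <= u -> u <= v -> v <= b -> `|h v - h u| <= L * (v - u)) ->
  ac_on a b h.
Proof.
move=> L0 hL e e0; have L1 : 0 < L + 1 by lra.
exists (e / (L + 1)) => [|k u v uv _]; first exact: divr_gt0.
rewrite ltr_pdivlMr// => sd.
have : \sum_(i < k) `|h (v i) - h (u i)| <= L * \sum_(i < k) (v i - u i).
  by rewrite mulr_sumr; apply: ler_sum => i _; have [] := uv i; exact: hL.
have : 0 <= \sum_(i < k) (v i - u i).
  by apply: sumr_ge0 => i _; have [_ ? _] := uv i; rewrite subr_ge0.
nra.
Qed.

(** * Regularity of absolutely continuous solutions *)

Section absolutely_continuous_curves.
Context {R : realType} {n : nat} (x : R -> 'rV[R]_n).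
Hypothesis x_ac : forall T, 0 < T -> abs_continuous_on 0 T x.

Lemma ac_curve_continuous t : 0 <= t -> forall e, 0 < e ->
  exists2 d, 0 < d & forall s, 0 <= s -> `|s - t| < d -> `|x s - x t| <= e.
Proof.
move=> t0 e e0; have T0 : 0 < t + 1 by lra.
have [d d0 Hd] := x_ac T0 e0.
exists (Num.min d 1) => [|s s0]; first by rewrite lt_min d0 ltr01.
rewrite lt_min => /andP[sd s1].
have step (u v : R) : 0 <= u -> u <= v -> v <= t + 1 -> v - u < d ->
    `|x v - x u| <= e.
  move=> u0 uv vT uvd.
  have := Hd 1%N (fun=> u) (fun=> v); rewrite !big_ord1 => H.
  rewrite (le_trans (row_norm_le_enorm _))// ltW// H//.
  by move=> i j _ _ _; rewrite !ord1.
have [st|ts] := leP s t.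
  rewrite distrC; apply: step => //; first by lra.
  by move: sd; rewrite distrC ger0_norm// subr_ge0.
move: sd s1; rewrite ger0_norm ?subr_ge0 ?(ltW ts)// => sd s1.
by apply: step => //; lra.
Qed.

(** With [c] equal to 1 or -1, monotonicity of these functions bounds the increments of a coordinate
    from both sides. *)
Lemma ac_curve_component (a b C c : R) i : 0 <= a -> a <= b ->
  ac_on a b (fun t => c * x t ord0 i - C * t).
Proof.
move=> a0 ab e e0; have T0 : 0 < b + 1 by lra.
pose k := 2 * (`|c| + 1); have k0 : 0 < k by rewrite mulr_gt0// ltr_wpDl.
have ek : 0 < e / k by exact: divr_gt0.
have [d d0 Hd] := x_ac T0 ek.
pose k' := 2 * (`|C| + 1); have k'0 : 0 < k' by rewrite mulr_gt0// ltr_wpDl.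
have ek' : 0 < e / k' by exact: divr_gt0.
exists (Num.min d (e / k')) => [|p u v uv tuv]; first by rewrite lt_min d0.
rewrite lt_min => /andP[sd sk'].
have uv' j : [/\ 0 <= u j, u j <= v j & v j <= b + 1].
  by have [auj ujvj vjb] := uv j; split => //; lra.
have := Hd _ u v uv' tuv sd; set E := \sum_(j < p) enorm _ => HE.
have : \sum_(j < p) `|c * x (v j) ord0 i - C * v j -
    (c * x (u j) ord0 i - C * u j)| <=
    `|c| * E + `|C| * \sum_(j < p) (v j - u j).
  rewrite !mulr_sumr -big_split/=; apply: ler_sum => j _.
  have [_ ujvj _] := uv j.
  have -> : c * x (v j) ord0 i - C * v j - (c * x (u j) ord0 i - C * u j) =
      c * (x (v j) - x (u j)) ord0 i - C * (v j - u j) by rewrite !mxE; ring.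
  rewrite (le_trans (ler_normB _ _))// !normrM lerD//.
    by rewrite ler_wpM2l// row_entry_le_enorm.
  by rewrite [X in _ * X]ger0_norm ?subr_ge0.
have E0 : 0 <= E by apply: sumr_ge0 => j _; exact: sqrtr_ge0.
have S0 : 0 <= \sum_(j < p) (v j - u j).
  by apply: sumr_ge0 => j _; have [_ ? _] := uv j; rewrite subr_ge0.
move: HE sk'; rewrite !ltr_pdivlMr// /k /k' => HE sk'.
have := normr_ge0 c; have := normr_ge0 C; lra.
Qed.

Variable X : 'rV[R]_n -> 'rV[R]_n.
Hypothesis X_bounded : forall p, exists C r : R, 0 < r /\
  forall y, `|y - p| < r -> `|X y| <= C.
Hypothesis x_ode : {ae (@lebesgue_measure R), forall t, 0 <= t ->
  derivable x t 1 /\ derive1 x t = X (x t)}.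

(** Near [x t] the field is bounded by some [C], so plus or minus each coordinate, minus [C] times
    the time, has nonpositive derivative almost everywhere; being absolutely continuous, it is
    nonincreasing. *)
Lemma ode_locally_lipschitz t : 0 <= t -> exists L d : R, [/\ 0 <= L, 0 < d &
  forall s s', 0 <= s -> 0 <= s' -> `|s - t| < d -> `|s' - t| < d ->
    `|x s' - x s| <= L * `|s' - s|].
Proof.
move=> t0; have [C [r [r0 XC]]] := X_bounded (x t).
have r2 : 0 < r / 2 by rewrite divr_gt0.
have [d d0 Hd] := ac_curve_continuous t0 r2.
have C0 : 0 <= C by apply: le_trans (XC (x t) _); rewrite ?subrr ?normr0.
exists C, d; split => //.
suff H s s' : 0 <= s -> s <= s' -> `|s - t| < d -> `|s' - t| < d ->
    `|x s' - x s| <= C * `|s' - s|.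
  move=> s s' s0 s'0 sd s'd; have [ss'|s's] := leP s s'; first exact: H.
  by rewrite distrC (distrC s'); apply: H => //; exact: ltW.
move=> s0 ss' sd s'd; rewrite ger0_norm ?subr_ge0//.
apply: row_norm_le => [|i]; first by rewrite mulr_ge0// subr_ge0.
have comp c : `|c| = 1 ->
    c * (x s' ord0 i - x s ord0 i) <= C * (s' - s).
  move=> c1.
  suff : c * x s' ord0 i - C * s' <= c * x s ord0 i - C * s by lra.
  apply: (ac_nonincreasing ss' (ac_curve_component C c i s0 ss')).
  move: x_ode; apply: (filterS
    (Filter := ae_filter_ringOfSetsType (@lebesgue_measure R))).
  move=> q odeq /andP[sq qs'].
  have [|dq xq] := odeq; first by lra.
  have XqC : `|X (x q)| <= C.
    apply: XC; rewrite (le_lt_trans (Hd q _ _))//; first by lra.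
      by move: sd s'd; rewrite !ltr_distl => /andP[? ?] /andP[? ?];
        apply/andP; split; lra.
    by lra.
  move=> e e0; have [d' d'0 Hd'] := derivable_expansion dq e0.
  have bd w : `|w - q| < d' ->
      `|c * (x w ord0 i - x q ord0 i - (w - q) * X (x q) ord0 i)| <=
      e * `|w - q|.
    move=> /Hd'; rewrite xq normrM c1 mul1r; apply: le_trans.
    apply: le_trans (row_entry_le _ i).
    by rewrite !mxE.
  have cX : c * X (x q) ord0 i <= C.
    by rewrite (le_trans (ler_norm _))// normrM c1 mul1r (le_trans _ XqC)//
      row_entry_le.
  exists d' => // u w qu uq qw wq.
  have := bd w; have := bd u.
  have -> : `|u - q| = q - u by rewrite distrC ger0_norm ?subr_ge0.
  have -> : `|w - q| = w - q by rewrite ger0_norm ?subr_ge0.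
  move=> Hu Hw.
  have /Hu : q - u < d' by lra.
  have /Hw : w - q < d' by lra.
  rewrite !ler_norml => /andP[_ Hw'] /andP[Hu' _].
  have : (w - u) * (c * X (x q) ord0 i) <= (w - u) * C.
    by rewrite ler_wpM2l// subr_ge0 (le_trans uq).
  by lra.
rewrite !mxE ler_norml; apply/andP; split.
  by have := comp (-1) (normrN1 _); lra.
by have := comp 1 (normr1 _); lra.
Qed.

End absolutely_continuous_curves.

(** * Decrease of a piecewise strictly differentiable function along a solution *)

Section lyapunov_descent.
Context {R : realType} {n m : nat} (C : 'I_m -> set 'rV[R]_n)
  (V W : 'rV[R]_n -> R) (X : 'rV[R]_n -> 'rV[R]_n) (x : R -> 'rV[R]_n).
Hypothesis C_closed : forall j, closed (C j).
Hypothesis V_strict : forall j q, C j q ->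
  exists p, strict_gradient (C j) V q p.
Hypothesis V_descent : forall q, exists j p,
  [/\ C j q, strict_gradient (C j) V q p & dot p (X q) <= - W q].
Hypothesis X_bounded : forall p, exists C r : R, 0 < r /\
  forall y, `|y - p| < r -> `|X y| <= C.
Hypothesis x_ac : forall T, 0 < T -> abs_continuous_on 0 T x.
Hypothesis x_ode : {ae (@lebesgue_measure R), forall t, 0 <= t ->
  derivable x t 1 /\ derive1 x t = X (x t)}.

(** The pieces missing [q] are closed and finite in number, hence all stay away from some ball
    around [q]. *)
Lemma pieces_near q : exists2 r, 0 < r &
  forall j y, `|y - q| < r -> C j y -> C j q.
Proof.
apply: (@uniform_radius R m
  (fun j r => forall y, `|y - q| < r -> C j y -> C j q)).
  by move=> j r r' rr' H y yr'; apply: H; exact: lt_le_trans rr'.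
move=> j; have [Cq|nCq] := pselect (C j q); first by exists 1.
have /nbhs_ballP[r /= r0 rC] : nbhs q (~` C j).
  by apply: open_nbhs_nbhs; split => //; exact/closed_openC.
exists r => // y yr Cy; exfalso; apply: (rC y) => //.
by rewrite -ball_normE/= distrC.
Qed.

Lemma piecewise_lipschitz q : exists L r : R, [/\ 0 <= L, 0 < r &
  forall j y z, C j y -> C j z -> `|y - q| < r -> `|z - q| < r ->
    `|V z - V y| <= L * `|z - y|].
Proof.
have [r r0 rC] := pieces_near q.
have /(_ _)/cid-/all_sig[L HL] : forall j, exists L, exists2 r, 0 < r &
    forall y z, C j y -> C j z -> `|y - q| < r -> `|z - q| < r ->
    `|V z - V y| <= L * `|z - y|.
  move=> j; have [Cq|nCq] := pselect (C j q); last first.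
    (* No point of this piece lies in the ball, so any constant serves. *)
    by exists 0, r => // y z Cy _ /rC/(_ Cy).
  have [p /(_ 1 ltr01)[d d0 Hd]] := V_strict Cq.
  exists (1 + n%:R * `|p|), d => // y z Cy Cz yd zd.
  have := Hd y z Cy Cz yd zd; have := norm_dot_le p (z - y).
  have := ler_normD (V z - V y - dot p (z - y)) (dot p (z - y)).
  by rewrite subrK mulrDl; lra.
have [j r1 r2 r21 H y z Cy Cz yr zr||r' r'0 Hr'] := @uniform_radius R m
    (fun j r => forall y z, C j y -> C j z -> `|y - q| < r -> `|z - q| < r ->
      `|V z - V y| <= L j * `|z - y|).
- by apply: H => //; exact: lt_le_trans r21.
- by move=> j; have [d] := HL j; exists d.
exists (\big[Num.max/0]_j L j), r'; split => //.
  by apply/bigmax_geP; left.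
move=> j y z Cy Cz yr zr; rewrite (le_trans (Hr' _ _ _ Cy Cz yr zr))//.
by rewrite ler_wpM2r//; exact: le_bigmax.
Qed.

(** For [u] near [q], every piece containing [x u] also contains [x q], so the Lipschitz bound of
    that piece compares the two values. Cousin's lemma chains these comparisons, although the
    endpoints of the interval may share no piece. *)
Lemma curve_lipschitz t : 0 <= t -> exists L d : R, [/\ 0 <= L, 0 < d &
  forall s s', 0 <= s -> 0 <= s' -> `|s - t| < d -> `|s' - t| < d ->
    `|V (x s') - V (x s)| <= L * `|s' - s|].
Proof.
move=> t0; have [L [r [L0 r0 HL]]] := piecewise_lipschitz (x t).
have [K [d1 [K0 d10 HK]]] := ode_locally_lipschitz x_ac X_bounded x_ode t0.
have r2 : 0 < r / 2 by rewrite divr_gt0.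
have [d2 d20 Hd2] := ac_curve_continuous x_ac t0 r2.
pose d := Num.min d1 d2.
have d0 : 0 < d by rewrite lt_min d10.
exists (L * K), d; split => //; first exact: mulr_ge0.
suff H s s' : 0 <= s -> s <= s' -> `|s - t| < d -> `|s' - t| < d ->
    `|V (x s') - V (x s)| <= L * K * `|s' - s|.
  move=> s s' s0 s'0 sd s'd; have [ss'|s's] := leP s s'; first exact: H.
  by rewrite distrC (distrC s'); apply: H => //; exact: ltW.
move=> s0 ss' sd s'd; rewrite (ger0_norm (_ : 0 <= s' - s)) ?subr_ge0//.
apply: (@cousin _ (fun u w => `|V (x w) - V (x u)| <= L * K * (w - u))) => //.
  move=> u v w _ _ _ _ H1 H2.
  by have := ler_distD (V (x v)) (V (x w)) (V (x u)); lra.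
move=> q /andP[sq qs'].
have q0 : 0 <= q by exact: le_trans sq.
have near_t u : s <= u -> u <= s' -> `|u - t| < d.
  by move: sd s'd; rewrite !ltr_distl => /andP[? ?] /andP[? ?] ? ?;
    apply/andP; split; lra.
have [r' r'0 Hr'] := pieces_near (x q).
have r'2 : 0 < r' / 2 by rewrite divr_gt0.
have [d' d'0 Hd'] := ac_curve_continuous x_ac q0 r'2.
have bd u : s <= u -> u <= s' -> `|u - q| < d' ->
    `|V (x u) - V (x q)| <= L * K * `|u - q|.
  move=> su us' uq; have u0 : 0 <= u by exact: le_trans su.
  have [j [_ [Cj _ _]]] := V_descent (x u).
  have Cq : C j (x q).
    by apply: Hr' Cj; rewrite (le_lt_trans (Hd' _ _ _))//; lra.
  have := near_t _ su us'; have := near_t _ sq qs'.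
  rewrite !lt_min => /andP[q1 q2] /andP[u1 u2].
  have xr w : 0 <= w -> `|w - t| < d2 -> `|x w - x t| < r.
    by move=> w0 wd; rewrite (le_lt_trans (Hd2 _ w0 wd))//; lra.
  rewrite (le_trans (HL j _ _ Cq Cj (xr _ q0 q2) (xr _ u0 u2)))// -mulrA.
  by rewrite ler_wpM2l// HK.
exists d' => // u w su ws' qu uq qw wq.
have : `|V (x u) - V (x q)| <= L * K * `|u - q|.
  apply: bd => //; first exact: le_trans qs'.
  by rewrite distrC ger0_norm ?subr_ge0//; lra.
have : `|V (x w) - V (x q)| <= L * K * `|w - q|.
  apply: bd => //; first exact: le_trans qw.
  by rewrite ger0_norm ?subr_ge0//; lra.
have -> : `|u - q| = q - u by rewrite distrC ger0_norm ?subr_ge0.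
have -> : `|w - q| = w - q by rewrite ger0_norm ?subr_ge0.
have := ler_distD (V (x q)) (V (x w)) (V (x u)).
by rewrite (distrC (V (x q))); lra.
Qed.

(** Closedness gives access to [lebesgue_density_dense]. *)
Lemma closed_visiting_times j : closed [set t | 0 <= t /\ C j (x t)].
Proof.
move=> t ct; have t0 : 0 <= t.
  rewrite leNgt; apply/negP => t0.
  have Nt0 : 0 < - t by lra.
  have [s [[s0 _]]] := ct _ (nbhsx_ballx t _ Nt0).
  by rewrite /ball/= ltr_distlC => /andP[]; lra.
split => //; apply: C_closed => B /nbhs_ballP[e /= e0 eB].
have e2 : 0 < e / 2 by rewrite divr_gt0.
have [d d0 Hd] := ac_curve_continuous x_ac t0 e2.
have [s [[s0 Cs]]] := ct _ (nbhsx_ballx t _ d0).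
rewrite /ball/= distrC => st; exists (x s); split => //; apply: eB.
by rewrite -ball_normE/= distrC (le_lt_trans (Hd _ s0 st))//; lra.
Qed.

(* At a density point [t] of the times spent in [C j], the increment of [V]
   along the curve may be computed at nearby times of that set, where the
   gradient [p] of the piece applies. *)
Lemma curve_derivative t j p : 0 < t -> derivable x t 1 ->
  C j (x t) -> strict_gradient (C j) V (x t) p ->
  (forall e, 0 < e -> exists2 d, 0 < d & forall s, `|s - t| < d ->
      exists2 s', 0 <= s' /\ C j (x s') & `|s' - s| <= e * `|s - t|) ->
  forall e, 0 < e -> exists2 d, 0 < d & forall s, `|s - t| < d ->
    `|V (x s) - V (x t) - (s - t) * dot p (derive1 x t)| <= e * `|s - t|.
Proof.
move=> t0 dx Ct strict dens e e0.
have arith (L K N c a A1 A2 A3 A4 : R) : `|A1| <= L * (c * a) ->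
    `|A2| <= c * (K * (2 * a)) -> `|A3| <= N * (K * (c * a)) ->
    `|A4| <= N * (c * a) -> 0 <= c * a ->
    `|A1 + A2 + A3 + A4| <= c * (L + 2 * K + N * K + N + 1) * a.
  rewrite !ler_norml => /andP[? ?] /andP[? ?] /andP[? ?] /andP[? ?] ?.
  by apply/andP; split; lra.
have [L [d1 [L0 d10 HL]]] := curve_lipschitz (ltW t0).
have [K [d2 [K0 d20 HK]]] :=
  ode_locally_lipschitz x_ac X_bounded x_ode (ltW t0).
pose N := n%:R * `|p|.
have N0 : 0 <= N by exact: mulr_ge0.
(* Coefficients of the errors [E1] to [E4]; the final 1 makes [k] positive. *)
pose k := L + 2 * K + N * K + N + 1.
have NK0 : 0 <= N * K by exact: mulr_ge0.
have k0 : 0 < k by rewrite /k; lra.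
pose c := Num.min 1 (e / k).
have c0 : 0 < c by rewrite lt_min ltr01 divr_gt0.
have c1 : c <= 1 by rewrite ge_min lexx.
have ck : c * k <= e by rewrite -ler_pdivlMr// ge_min lexx orbT.
have [d3 d30 H3] := derivable_expansion dx c0.
have [d4 d40 H4] := dens _ c0.
have [r r0 Hr] := strict _ c0.
have r2 : 0 < r / 2 by rewrite divr_gt0.
have r2r : r / 2 < r by rewrite ltr_pdivrMr// ltr_pMr// ltr1n.
have [d5 d50 H5] := ac_curve_continuous x_ac (ltW t0) r2.
pose d := Num.min (Num.min (Num.min d1 d2) (Num.min d3 d4)) (Num.min d5 t).
have d0 : 0 < d by rewrite !lt_min d10 d20 d30 d40 d50 t0.
(* As [c <= 1], the visiting time [s'] is at most twice as far from [t] as [s]. The bound [t] inside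
   [d] keeps the times positive. *)
exists (d / 2) => [|s sd2]; first by rewrite divr_gt0.
have near_t u : `|u - t| < d -> [/\ `|u - t| < d1, `|u - t| < d2,
    `|u - t| < d3, `|u - t| < d4 & `|u - t| < d5 /\ 0 < u].
  rewrite !lt_min => /andP[/andP[/andP[-> ->] /andP[-> ->]] /andP[-> ut]].
  by split => //; split => //; move: ut; rewrite ltr_distl => /andP[]; lra.
have sd : `|s - t| < d.
  by rewrite (lt_trans sd2)// ltr_pdivrMr// ltr_pMr// ltr1n.
have [s1 s2 s3 s4 [s5 s0]] := near_t _ sd.
have [s' [s'0 Cs'] s's] := H4 _ s4.
have s's1 : `|s' - s| <= `|s - t|.
  by rewrite (le_trans s's)// -[leRHS]mul1r ler_wpM2r.
have s'd : `|s' - t| < d.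
  rewrite (le_lt_trans (ler_distD s _ _))// (splitr d) ltrD//.
  exact: le_lt_trans s's1 _.
have [s'1 s'2 _ _ [s'5 _]] := near_t _ s'd.
have t1 : `|t - t| < d by rewrite subrr normr0.
have [t_1 t_2 _ _ [t_5 _]] := near_t _ t1.
set a := `|s - t| in s's s's1 *.
have a0 : 0 <= a by exact: normr_ge0.
have E1 : `|V (x s) - V (x s')| <= L * (c * a).
  by rewrite (le_trans (HL _ _ s'0 (ltW s0) s'1 s1))// ler_wpM2l// distrC.
have xs't : `|x s' - x t| <= K * (2 * a).
  rewrite (le_trans (HK _ _ (ltW t0) s'0 t_2 s'2))// ler_wpM2l//.
  by rewrite (le_trans (ler_distD s _ _))// mulr_natl mulr2n lerD.
have E2 : `|V (x s') - V (x t) - dot p (x s' - x t)| <= c * (K * (2 * a)).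
  rewrite (le_trans (Hr _ _ Ct Cs' _ _))//.
  - by rewrite subrr normr0.
  - by rewrite (le_lt_trans (H5 _ s'0 s'5)).
  - by rewrite ler_wpM2l// ltW.
have E3 : `|dot p (x s' - x s)| <= N * (K * (c * a)).
  rewrite (le_trans (norm_dot_le _ _))// ler_wpM2l//.
  by rewrite (le_trans (HK _ _ (ltW s0) s'0 s2 s'2))// ler_wpM2l.
have E4 : `|dot p (x s - x t - (s - t) *: derive1 x t)| <= N * (c * a).
  by rewrite (le_trans (norm_dot_le _ _))// ler_wpM2l// H3.
have -> : V (x s) - V (x t) - (s - t) * dot p (derive1 x t) =
    (V (x s) - V (x s')) + (V (x s') - V (x t) - dot p (x s' - x t)) +
    dot p (x s' - x s) + dot p (x s - x t - (s - t) *: derive1 x t).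
  by rewrite !dotBr dotZr; ring.
have Ea : c * k * a <= e * a by rewrite ler_wpM2r.
have ca0 : 0 <= c * a by rewrite mulr_ge0 ?(ltW c0).
by apply: le_trans Ea; exact: (arith _ _ _ _ _ _ _ _ _ E1 E2 E3 E4 ca0).
Qed.

(** On short intervals [V (x s) + c * s] is Lipschitz, hence absolutely continuous, and almost
    everywhere its derivative is at most [c - W (x s)], so nonpositive. Cousin's lemma joins the
    intervals. *)
Lemma lyapunov_decrease a b c : 0 <= a -> a <= b ->
  (forall t, a <= t <= b -> c <= W (x t)) ->
  V (x b) <= V (x a) - c * (b - a).
Proof.
move=> a0 ab cW.
suff : V (x b) + c * b <= V (x a) + c * a by lra.
apply: (@cousin _ (fun u w => V (x w) + c * w <= V (x u) + c * u)) => //.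
  by move=> u v w _ _ _ _ H1 H2; exact: le_trans H1.
move=> t /andP[at_ tb]; have t0 : 0 <= t by exact: le_trans at_.
have [L [d [L0 d0 HL]]] := curve_lipschitz t0.
exists d => // u w au wb tu ut tw wt.
have u0 : 0 <= u by exact: le_trans au.
apply: (@ac_nonincreasing _ u w (fun s => V (x s) + c * s)).
- exact: le_trans tw.
- apply: (@lipschitz_ac _ _ _ (L + `|c|)); first by rewrite addr_ge0.
  move=> p q up pq qw.
  have pt : `|p - t| < d by rewrite ltr_distl; apply/andP; split; lra.
  have qt : `|q - t| < d by rewrite ltr_distl; apply/andP; split; lra.
  have p0 : 0 <= p by exact: le_trans up.
  have := HL _ _ p0 (le_trans p0 pq) pt qt.
  have -> : V (x q) + c * q - (V (x p) + c * p) =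
    (V (x q) - V (x p)) + c * (q - p) by ring.
  rewrite (ger0_norm (_ : 0 <= q - p)) ?subr_ge0// mulrDl => H.
  rewrite (le_trans (ler_normD _ _))// lerD// normrM ler_wpM2l//.
  by rewrite ger0_norm ?subr_ge0.
(* The density property must hold for all pieces at once, since the piece supplied by [V_descent]
   depends on [s]. *)
- have dens : {ae (@lebesgue_measure R), forall s j,
      0 <= s /\ C j (x s) -> forall e, 0 < e -> exists2 d, 0 < d &
      forall s', `|s' - s| < d -> exists2 s'', 0 <= s'' /\ C j (x s'') &
        `|s'' - s'| <= e * `|s' - s|}.
    apply: (@filter_forall _ _ _ _
      (ae_filter_ringOfSetsType (@lebesgue_measure R))) => j.
    move: (lebesgue_density_dense (@closed_visiting_times j)).
    apply: (filterS
      (Filter := ae_filter_ringOfSetsType (@lebesgue_measure R))) => s H.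
    exact: H.
  have := filterI (Filter := ae_filter_ringOfSetsType (@lebesgue_measure R))
    dens x_ode.
  apply: (filterS (Filter := ae_filter_ringOfSetsType (@lebesgue_measure R))).
  move=> s [denss odes] /andP[us sw] e e0.
  have s0 : 0 < s by exact: le_lt_trans us.
  have [dxs xs] := odes (ltW s0).
  have [j [p [Cj strict desc]]] := V_descent (x s).
  have [d' d'0 Hd'] := curve_derivative s0 dxs Cj strict
    (denss j (conj (ltW s0) Cj)) e0.
  have Wc : dot p (derive1 x s) <= - c.
    by rewrite xs (le_trans desc)// lerN2 cW//; apply/andP; split; lra.
  exists d' => // y z sy ys sz zs.
  have := Hd' y; have := Hd' z.
  have -> : `|y - s| = s - y by rewrite distrC ger0_norm ?subr_ge0.
  have -> : `|z - s| = z - s by rewrite ger0_norm ?subr_ge0.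
  have zs' : z - s < d' by lra.
  have sy' : s - y < d' by lra.
  move=> /(_ zs') + /(_ sy'); rewrite !ler_norml => /andP[_ Hz] /andP[Hy _].
  have : (z - y) * dot p (derive1 x s) <= (z - y) * - c.
    by rewrite ler_wpM2l// subr_ge0 (le_trans ys).
  by lra.
Qed.

End lyapunov_descent.

(** * The switching law *)

Lemma locally_lipschitz_continuous (R : realType) (n : nat)
    (g : 'rV[R]_n -> 'rV[R]_n) : locally_lipschitz g -> continuous g.
Proof.
move=> lg x; have [U Ux] := lg x => /pinfty_ex_gt0[K K0 HK].
have /nbhs_ballP[r /= r0 rU] := Ux.
apply/continuous_atP => e e0.
exists (Num.min r (e / K)) => [|y]; first by rewrite lt_min r0 divr_gt0.
rewrite lt_min => /andP[yr]; rewrite ltr_pdivlMr// mulrC => /ltW yK.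
apply: le_trans yK; apply: (HK (y, x)); split => /=; last exact: nbhs_singleton.
by apply: rU; rewrite -ball_normE/= distrC.
Qed.

Lemma cvg_dot (R : realType) (n : nat) (T : Type) (F : set_system T)
    (FF : Filter F) (a b : T -> 'rV[R]_n) (p q : 'rV[R]_n) :
  a @ F --> p -> b @ F --> q -> dot (a y) (b y) @[y --> F] --> dot p q.
Proof.
move=> ap bq; apply: cvg_big => [|i _]; first exact: add_continuous.
apply: cvgM.
  apply: (cvg_comp a (fun u : 'rV[R]_n => u ord0 i) ap).
  exact: coord_continuous.
apply: (cvg_comp b (fun u : 'rV[R]_n => u ord0 i) bq).
exact: coord_continuous.
Qed.

Lemma enorm_continuous (R : realType) (n : nat) : continuous (@enorm R n).
Proof.
move=> u; apply: continuous_comp; last exact: sqrt_continuous.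
by apply: (@cvg_dot _ _ _ (nbhs u) _ id id); exact: cvg_id.
Qed.

Lemma dirderiv_differentiable (R : realType) (n : nat) (g : 'rV[R]_n -> R)
    (x v : 'rV[R]_n) : differentiable g x -> dirderiv g x v = dot (grad g x) v.
Proof.
move=> dg; rewrite -diff_dot_grad// -deriveE//.
have /cvg_dnbhs_at_right := @diff_derivable _ _ _ g x v dg.
rewrite -/(derive g x v) => H.
apply: cvg_lim => //; move: H; apply: cvg_trans; apply: near_eq_cvg.
by near=> d; rewrite /= [x + _]addrC.
Unshelve. all: by end_near. Qed.

Lemma enorm0 (R : realType) (n : nat) : enorm (0 : 'rV[R]_n) = 0.
Proof.
rewrite /enorm /dot big1 ?sqrtr0// => i _.
by rewrite !mxE mul0r.
Qed.

Lemma positive_lower_bound (R : realType) (n : nat) (F : 'rV[R]_n -> R)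
    (A : set 'rV[R]_n) :
  continuous F -> closed A -> bounded_set A ->
  (forall z, A z -> 0 < F z) -> exists2 c, 0 < c & forall z, A z -> c <= F z.
Proof.
move=> cF clA bA F0; have [A0|A0] := pselect (A !=set0); last first.
  (* Any positive constant serves on an empty set, such as a sphere in dimension 0. *)
  by exists 1 => // z Az; exfalso; apply: A0; exists z.
have cA := bounded_closed_compact bA clA.
have [z zA Fz] := EVT_min_rV A0 cA (continuous_subspaceT cF).
exists (F z) => [|y Ay]; first by apply: F0; rewrite inE in zA.
by apply: Fz; rewrite inE.
Qed.

Lemma closed_enorm_preimage (R : realType) (n : nat) (B : set R) : closed B ->
  closed [set z : 'rV[R]_n | B (enorm z)].
Proof.
by move=> cB; apply: preimage_closed => // z _; exact: enorm_continuous.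
Qed.

(** * Descent, trapping and attraction for the closed loop *)

Section closed_loop_stability.
Context {R : realType} {n M m : nat} (f : 'I_M -> 'rV[R]_n -> 'rV[R]_n)
  (V W : 'rV[R]_n -> R) (Om : 'I_m -> set 'rV[R]_n) (nu : 'rV[R]_n -> 'I_M).
Hypothesis f_lipschitz : forall i, locally_lipschitz (f i).
Hypothesis VW_clf : clf_pair f V W Om.
Hypothesis V_grad : gradients_extend V Om.
Hypothesis nu_law : switching_law f V Om nu.
Hypothesis nu_admissible : admissible_law f V Om.

Let V_ps := clf_smooth VW_clf.
Let Om_open := ps_open V_ps.

Lemma in_piece_or_boundary j q :
  closure (Om j) q -> Om j q \/ boundary (Om j) q.
Proof.
move=> cq; have [Oq|nOq] := pselect (Om j q); first by left.
by right; split => //; rewrite ((interior_id _).1 (@Om_open j)).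
Qed.

Lemma gradient_limit j (q : 'rV[R]_n) : closure (Om j) q ->
  exists p : 'rV[R]_n, grad V @ within (Om j) (nbhs q) --> p.
Proof.
move=> /in_piece_or_boundary[Oq|bq].
  exists (grad V q); apply: cvg_within_filter.
  by have [_] := ps_C1 V_ps Oq.
by have /cvg_ex[p gp] := V_grad bq; exists p.
Qed.

Lemma gradient_limit_strict j (q p : 'rV[R]_n) : closure (Om j) q ->
  grad V @ within (Om j) (nbhs q) --> p ->
  strict_gradient (closure (Om j)) V q p.
Proof.
move=> cq gp; apply: strict_differentiability => //.
- exact: ps_continuous V_ps.
- by move=> y Oy; have [] := ps_C1 V_ps Oy.
- case: (in_piece_or_boundary cq) => [Oq|bq]; first exact: quasiconvex_interior.
  by apply: quasiconvex_boundary => //; exact: ps_manifold V_ps j.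
Qed.

(** Some mode [k] attains the rate [- W y], and where mode [i] dominates its rate is no larger than
    that of [k]. *)
Lemma dominance_descent j i y : dominance_piece f V Om j i y ->
  dot (grad V y) (f i y) <= - W y.
Proof.
move=> [Oy dom]; have [dV _] := ps_C1 V_ps Oy.
have /bigmin_leP[|[k _]] := clf_decrease VW_clf y; first by rewrite leye_eq.
rewrite lee_fin dirderiv_differentiable// => kW.
have [<-//|ki] := eqVneq k i.
rewrite (le_trans _ kW)// -lee_fin ltW// (lt_le_trans dom)//.
exact: bigmin_le_cond.
Qed.

(** By admissibility [q] is in the closure of a dominance region. In the interior, [nu q] is the
    index of that region; otherwise [q] is on a boundary and the second clause of the law applies. A
    finite union then passes the closure to one piece. *)
Lemma law_closure q : exists j, closure (dominance_piece f V Om j (nu q)) q.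
Proof.
have cl : closure (dominance f V Om (nu q)) q.
  have [i _ ci] : (\bigcup_i closure (dominance f V Om i)) q.
    by rewrite (adm_cover nu_admissible).
  have [/interior_subset Di|nDi] := pselect (interior (dominance f V Om i) q).
    by rewrite (law_interior nu_law Di).
  have bq : dominance_boundary f V Om q by exists i.
  by have [[]] := law_boundary nu_law bq.
apply: contrapT => /forallNP ncl.
have : \forall y \near q, forall j, ~ dominance_piece f V Om j (nu q) y.
  apply: (@filter_forall _ _ _ (nbhs q)) => j.
  have : nbhs q (~` closure (dominance_piece f V Om j (nu q))).
    apply: open_nbhs_nbhs; split; last exact: ncl.
    exact/closed_openC/closed_closure.
  by apply: filterS => y + Dy; apply; exact: subset_closure.
by move=> /cl[y [[j _ Dy]]] /(_ j).
Qed.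

(** The mode is frozen at [nu q] and the descent inequality passes to the limit from inside its
    dominance region, even when the law switches at [q]. *)
Lemma closed_loop_descent (q : 'rV[R]_n) : exists j p, [/\ closure (Om j) q,
  strict_gradient (closure (Om j)) V q p &
  dot p (closed_loop f nu q) <= - W q].
Proof.
have [j cD] := law_closure q.
have DO : dominance_piece f V Om j (nu q) `<=` Om j by move=> y [].
have cq : closure (Om j) q by exact: closureS cD.
have [p gp] := gradient_limit cq.
exists j, p; split => //; first exact: gradient_limit_strict.
pose D := dominance_piece f V Om j (nu q).
(* Proper because [q] is in the closure of [D], which makes the limit of the inequality
   meaningful. *)
have PF : ProperFilter (within D (nbhs q)) by exact: within_nbhs_proper.
have gD : grad V @ within D (nbhs q) --> p.
  apply: cvg_trans gp => B; rewrite /fmap /within/=.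
  by apply: (@filterS _ (nbhs q)) => y + /DO; apply.
have fD : f (nu q) @ within D (nbhs q) --> f (nu q) q.
  by apply: cvg_within_filter; exact: locally_lipschitz_continuous.
have WD : W @ within D (nbhs q) --> W q.
  by apply: cvg_within_filter; exact: clf_W_continuous VW_clf q.
have lim : (fun y => dot (grad V y) (f (nu q) y) + W y) @ within D (nbhs q) -->
    dot p (f (nu q) q) + W q.
  by apply: (@cvgD _ _ _ (within D (nbhs q))) => //; exact: cvg_dot.
rewrite -subr_le0 opprK /closed_loop.
have FD : \forall y \near within D (nbhs q),
    dot (grad V y) (f (nu q) y) + W y <= 0.
  have : \forall y \near within D (nbhs q), D y by exact: withinT.
  by apply: filterS => y /dominance_descent; rewrite -subr_le0 opprK.
by apply: (ler_cvg_to lim (cvg_cst 0)); exact: FD.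
Qed.

Lemma closed_loop_bounded p : exists C r : R, 0 < r /\
  forall y, `|y - p| < r -> `|closed_loop f nu y| <= C.
Proof.
have [i r1 r2 r21 H y yr|i|r r0 Hr] := @uniform_radius R M
    (fun i r => forall y, `|y - p| < r -> `|f i y - f i p| <= 1).
- by apply: H; exact: lt_le_trans r21.
- have cf := locally_lipschitz_continuous (f_lipschitz i).
  by have /continuous_atP := cf p; apply.
exists (1 + \big[Num.max/0]_i `|f i p|), r; split => // y yr.
have fy := Hr (nu y) y yr.
rewrite /closed_loop -(subrK (f (nu y) p) (f (nu y) y)).
rewrite (le_trans (ler_normD _ _))//.
by rewrite lerD//; exact: (le_bigmax _ (fun i => `|f i p|)).
Qed.

Definition nonsliding (x : R -> 'rV[R]_n) : Prop :=
  (forall T : R, 0 < T -> abs_continuous_on 0 T x) /\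
  {ae (@lebesgue_measure R), forall t : R, 0 <= t ->
     derivable x t 1 /\ derive1 x t = closed_loop f nu (x t)}.

Lemma nonsliding_decrease x a b c : nonsliding x -> 0 <= a -> a <= b ->
  (forall t, a <= t <= b -> c <= W (x t)) ->
  V (x b) <= V (x a) - c * (b - a).
Proof.
move=> [x_ac x_ode]; apply: (@lyapunov_decrease R n m (fun j => closure (Om j))
  V W (closed_loop f nu)) => //.
- by move=> j; exact: closed_closure.
- move=> j q cq; have [p gp] := gradient_limit cq.
  by exists p; exact: gradient_limit_strict.
- exact: closed_loop_descent.
- exact: closed_loop_bounded.
Qed.

Lemma nonsliding_nonincreasing x a b : nonsliding x -> 0 <= a -> a <= b ->
  V (x b) <= V (x a).
Proof.
move=> nx a0 ab; have := @nonsliding_decrease x a b 0 nx a0 ab.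
by rewrite mul0r subr0; apply => t _; exact: clf_W_ge0 VW_clf _.
Qed.

(* No curve along which [V] stays below its minimum over the sphere of radius
   [eps] can cross that sphere. *)
Lemma trapping eps : 0 < eps -> exists2 delta, 0 < delta &
  forall x t0, nonsliding x -> 0 <= t0 -> enorm (x t0) <= delta ->
  forall t, t0 <= t -> enorm (x t) < eps.
Proof.
move=> eps0.
have [||z Sz|mu mu0 Vmu] := @positive_lower_bound R n V
    [set z : 'rV[R]_n | enorm z = eps] (ps_continuous V_ps).
- exact: (closed_enorm_preimage (@closed_eq R eps)).
- exists eps; split; first exact: num_real.
  by move=> N /ltW eN z /= ze; rewrite (le_trans (row_norm_le_enorm z))// ze.
- apply: (clf_V_gt0 VW_clf); apply/eqP => z0; move: Sz eps0.
  by rewrite z0 /= enorm0 => <-; rewrite ltxx.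
have /continuous_atP/(_ (mu / 2))[|d d0 Hd] := @ps_continuous _ _ _ _ _ V_ps 0.
  by rewrite divr_gt0.
have d2 : 0 < d / 2 by rewrite divr_gt0.
have e2 : 0 < eps / 2 by rewrite divr_gt0.
(* The first bound puts [V] below its minimum over the sphere, the second starts the curve inside
   the sphere. *)
exists (Num.min (d / 2) (eps / 2)); first by rewrite lt_min d2.
move=> x t0 nx t00; rewrite le_min => /andP[xd xe] t t0t.
have Vmu0 : V (x t0) < mu.
  have /Hd : `|x t0 - 0| < d.
    by rewrite subr0 (le_lt_trans (row_norm_le_enorm _))//; lra.
  by rewrite (clf_V0 VW_clf) subr0 => /(le_trans (ler_norm _)); lra.
have off s : t0 <= s -> enorm (x s) != eps.
  move=> t0s; apply/eqP => /Vmu; apply/negP; rewrite -ltNge.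
  by rewrite (le_lt_trans (nonsliding_nonincreasing nx t00 t0s)).
have x0 : enorm (x t0) < eps by lra.
suff : enorm (x t0) < eps -> enorm (x t) < eps by exact.
apply: (@cousin _ (fun u w => enorm (x u) < eps -> enorm (x w) < eps)) => //.
  by move=> u v w _ _ _ _ H1 H2 /H1.
move=> s /andP[t0s st]; have s0 : 0 <= s by exact: le_trans t0s.
(* Half the distance to [eps]: a smaller variation keeps the Euclidean norm on the same side of
   [eps]. *)
have gap : 0 < `|enorm (x s) - eps| / 2.
  by rewrite divr_gt0// normr_gt0 subr_eq0 off.
have /continuous_atP/(_ _ gap)[r r0 Hr] := @enorm_continuous R n (x s).
have r2 : 0 < r / 2 by rewrite divr_gt0.
have [d' d'0 Hd'] := ac_curve_continuous nx.1 s0 r2.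
have same u : t0 <= u -> `|u - s| < d' ->
    `|enorm (x u) - enorm (x s)| <= `|enorm (x s) - eps| / 2.
  move=> t0u us; apply: Hr; rewrite (le_lt_trans (Hd' _ _ us))//; last by lra.
  exact: le_trans t0u.
exists d' => // u w t0u wt su us sw ws.
have := same u t0u; have := same w (le_trans t0u (le_trans us sw)).
have -> : `|u - s| < d' by rewrite ltr_distl; apply/andP; split; lra.
have -> : `|w - s| < d' by rewrite ltr_distl; apply/andP; split; lra.
move=> /(_ isT) + /(_ isT).
have [se|se] := ltP (enorm (x s)) eps.
  rewrite (ltr0_norm (_ : enorm (x s) - eps < 0)) ?subr_lt0//.
  by rewrite !ler_norml => /andP[? ?] /andP[? ?] _; lra.
rewrite (ger0_norm (_ : 0 <= enorm (x s) - eps)) ?subr_ge0//.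
rewrite !ler_norml => /andP[? ?] /andP[? ?] ?.
by have := off s t0s; rewrite eq_le se andbT -ltNge; lra.
Qed.

(** Otherwise the curve stays in a compact set avoiding 0, where [W] has a positive lower bound [c],
    and [V] would become negative. *)
Lemma attraction x delta : 0 < delta -> nonsliding x ->
  exists2 t, 0 <= t & enorm (x t) <= delta.
Proof.
move=> delta0 nx; apply: contrapT => far.
have {}far t : 0 <= t -> delta <= enorm (x t).
  move=> t0; apply: ltW; rewrite ltNge; apply/negP => xt.
  by apply: far; exists t.
have [|||c c0 Wc] := @positive_lower_bound R n W
    [set z : 'rV[R]_n | V z <= V (x 0) /\ delta <= enorm z]
    (clf_W_continuous VW_clf).
- apply: closedI; last exact: (closed_enorm_preimage (@closed_ge R delta)).
  apply: (@preimage_closed _ _ V [set r | r <= V (x 0)]); last exact: closed_le.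
  by move=> z _; exact: ps_continuous V_ps z.
- have [N [N_real HN]] := clf_bounded VW_clf (V (x 0)).
  by exists N; split => // K NK z [Vz _]; exact: HN NK z Vz.
- move=> z [_ dz]; apply: (clf_W_gt0 VW_clf); apply/eqP => z0.
  by move: dz; rewrite z0 enorm0; lra.
(* Decreasing at rate [c], [V] would be at most -1 at time [T]. *)
pose T := (V (x 0) + 1) / c.
have T0 : 0 <= T.
  by rewrite divr_ge0 ?(ltW c0)// addr_ge0//; exact: clf_V_ge0 VW_clf _.
have := @nonsliding_decrease x 0 T c nx (lexx 0) T0.
have -> : c * (T - 0) = V (x 0) + 1 by rewrite subr0 mulrC divfK// gt_eqF.
have := clf_V_ge0 VW_clf (x T).
suff : forall t, 0 <= t <= T -> c <= W (x t) by move=> H ? /(_ H); lra.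
move=> t /andP[t0 _]; apply: Wc; split; last exact: far.
exact: nonsliding_nonincreasing.
Qed.

End closed_loop_stability.

Unset Implicit Arguments.

Theorem theorem23 (R : realType) (n M m : nat)
    (f : 'I_M -> 'rV[R]_n -> 'rV[R]_n) (V W : 'rV[R]_n -> R)
    (Om : 'I_m -> set 'rV[R]_n) (nu : 'rV[R]_n -> 'I_M)
    (f_lipschitz : forall i, locally_lipschitz (f i))
    (f_0 : forall i, f i 0 = 0)
    (VW_clf : clf_pair f V W Om)
    (V_grad : gradients_extend V Om)
    (nu_law : switching_law f V Om nu)
    (nu_admissible : admissible_law f V Om) :
  gas_excluding_sliding f nu.
Proof.
have solution_nonsliding rho x :
    nonsliding_solutions f nu rho x -> nonsliding f nu x.
  by move=> [z [_ sol ae]]; split => //; exact: filippov_ac sol.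
have trap := trapping f_lipschitz VW_clf V_grad nu_law nu_admissible.
split=> [eps /trap[delta delta0 Hdelta]|rho x _ /solution_nonsliding nx].
  exists delta => // x sx t t0; have nx := solution_nonsliding _ _ sx.
  apply: (Hdelta x 0) => //.
  by have [z [zd sol _]] := sx; rewrite (filippov_init sol).
apply/cvgrPdist_lt => eps eps0.
have [delta delta0 Hdelta] := trap _ eps0.
(* The curve enters the ball of radius [delta] at some time [t0]; trapping from [t0] on then keeps
   it within [eps] of 0. *)
have [t0 t00 xt0] := attraction f_lipschitz VW_clf V_grad nu_law nu_admissible
  delta0 nx.
exists t0; split; first exact: num_real.
move=> t /ltW t0t; rewrite sub0r normrN.
exact: le_lt_trans (row_norm_le_enorm _) (Hdelta x t0 nx t00 xt0 t t0t).
Qed.
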